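(* If $A$ is a C*-algebra then $\mathcal{R}_{\mathrm{hf}}(A)=\mathcal{R}_{\mathrm{hc}}(A)$.
   Context: An element $a$ of a normed algebra $A$ is compact (resp. finite rank) if the operator $x\mapsto axa$ on $A$ is compact (resp. finite rank). A normed algebra is hypocompact (resp. hypofinite) if every non-zero quotient $A/J$ by a closed ideal $J$ has a non-zero compact (resp. finite rank) element; an ideal is hypocompact (hypofinite) if it is so as a normed algebra. For a Banach algebra $A$, $\mathcal{R}_{\mathrm{hc}}(A)$ (resp. $\mathcal{R}_{\mathrm{hf}}(A)$) denotes the largest hypocompact (resp. hypofinite) closed ideal of $A$, which exists. *)

(* Defs.v *)
From Stdlib Require Import Reals.
From Coquelicot Require Import Complex.
Set Implicit Arguments.
Open Scope R_scope.

Record CstarAlgebra := {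
  car :> Type;
  zero : car;
  add : car -> car -> car;
  opp : car -> car;
  mul : car -> car -> car;
  scal : C -> car -> car;
  star : car -> car;
  norm : car -> R;
  addA : forall x y z, add x (add y z) = add (add x y) z;
  addC : forall x y, add x y = add y x;
  add0 : forall x, add zero x = x;
  addN : forall x, add x (opp x) = zero;
  mulA : forall x y z, mul x (mul y z) = mul (mul x y) z;
  mulDl : forall x y z, mul (add x y) z = add (mul x z) (mul y z);
  mulDr : forall x y z, mul x (add y z) = add (mul x y) (mul x z);
  scal1 : forall x, scal (RtoC 1) x = x;
  scalA : forall a b x, scal a (scal b x) = scal (Cmult a b) x;
  scalDl : forall a b x, scal (Cplus a b) x = add (scal a x) (scal b x);
  scalDr : forall a x y, scal a (add x y) = add (scal a x) (scal a y);
  scal_mull : forall a x y, scal a (mul x y) = mul (scal a x) y;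
  scal_mulr : forall a x y, scal a (mul x y) = mul x (scal a y);
  norm_eq0 : forall x, norm x = 0 -> x = zero;
  norm_triangle : forall x y, norm (add x y) <= norm x + norm y;
  norm_scal : forall a x, norm (scal a x) = Cmod a * norm x;
  norm_mul : forall x y, norm (mul x y) <= norm x * norm y;
  complete : forall u : nat -> car,
    (forall eps, 0 < eps -> exists N, forall m n, (N <= m)%nat -> (N <= n)%nat ->
        norm (add (u m) (opp (u n))) < eps) ->
    exists l, forall eps, 0 < eps -> exists N, forall n, (N <= n)%nat ->
        norm (add (u n) (opp l)) < eps;
  star_invol : forall x, star (star x) = x;
  star_add : forall x y, star (add x y) = add (star x) (star y);
  star_scal : forall a x, star (scal a x) = scal (Cconj a) (star x);
  star_mul : forall x y, star (mul x y) = mul (star y) (star x);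
  cstar_id : forall x, norm (mul (star x) x) = norm x * norm x
}.

Section Defs.
Variable A : CstarAlgebra.
Notation sub x y := (add A x (opp A y)).

Definition cvg_to (u : nat -> A) (l : A) : Prop :=
  forall eps, 0 < eps -> exists N, forall n, (N <= n)%nat -> norm A (sub (u n) l) < eps.

Definition is_closed (S : A -> Prop) : Prop :=
  forall (u : nat -> A) l, (forall n, S (u n)) -> cvg_to u l -> S l.

Definition is_ideal_in (I K : A -> Prop) : Prop :=
  (forall x, K x -> I x) /\
  K (zero A) /\
  (forall x y, K x -> K y -> K (add A x y)) /\
  (forall x, K x -> K (opp A x)) /\
  (forall c x, K x -> K (scal A c x)) /\
  (forall x k, I x -> K k -> K (mul A x k) /\ K (mul A k x)).

Definition whole : A -> Prop := fun _ => True.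

Definition closed_ideal (I : A -> Prop) : Prop := is_ideal_in whole I /\ is_closed I.

(* Computation in the quotient normed space I/K (K closed ideal of I):
   the quotient norm of the class of x is  inf_{k in K} ||x - k||. *)

Definition qnorm_le (K : A -> Prop) (x : A) (c : R) : Prop :=
  forall eps, 0 < eps -> exists k, K k /\ norm A (sub x k) <= c + eps.

Definition qcvg_to (K : A -> Prop) (u : nat -> A) (y : A) : Prop :=
  forall eps, 0 < eps -> exists N, forall n, (N <= n)%nat ->
    exists k, K k /\ norm A (sub (sub (u n) y) k) < eps.

(* The operator  x + K |-> a x a + K  on the normed algebra I/K is compact:
   it maps bounded sets to relatively compact sets, i.e. every bounded
   sequence in I/K has a subsequence whose image converges in I/K. *)
Definition compact_elt_mod (I K : A -> Prop) (a : A) : Prop :=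
  forall u : nat -> A,
    (forall n, I (u n)) ->
    (exists c, forall n, qnorm_le K (u n) c) ->
    exists phi : nat -> nat,
      (forall n, (phi n < phi (S n))%nat) /\
      exists y, I y /\ qcvg_to K (fun n => mul A a (mul A (u (phi n)) a)) y.

Fixpoint lincomb (c : nat -> C) (y : nat -> A) (n : nat) : A :=
  match n with
  | O => zero A
  | S m => add A (lincomb c y m) (scal A (c m) (y m))
  end.

(* The operator  x + K |-> a x a + K  on I/K has finite rank: its range is
   contained in the span of finitely many classes y_0 + K, ..., y_{n-1} + K. *)
Definition finite_rank_elt_mod (I K : A -> Prop) (a : A) : Prop :=
  exists (n : nat) (y : nat -> A),
    (forall i, (i < n)%nat -> I (y i)) /\
    forall x, I x -> exists c : nat -> C,
      K (sub (mul A a (mul A x a)) (lincomb c y n)).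

(* The ideal I, as a normed algebra, is hypocompact (resp. hypofinite):
   every non-zero quotient I/K by a closed ideal K of I has a non-zero
   compact (resp. finite rank) element. *)
Definition hypocompact (I : A -> Prop) : Prop :=
  forall K, is_ideal_in I K -> is_closed K ->
    (exists x, I x /\ ~ K x) ->
    exists a, I a /\ ~ K a /\ compact_elt_mod I K a.

Definition hypofinite (I : A -> Prop) : Prop :=
  forall K, is_ideal_in I K -> is_closed K ->
    (exists x, I x /\ ~ K x) ->
    exists a, I a /\ ~ K a /\ finite_rank_elt_mod I K a.

Definition is_Rhc (I : A -> Prop) : Prop :=
  closed_ideal I /\ hypocompact I /\
  forall J, closed_ideal J -> hypocompact J -> forall x, J x -> I x.

Definition is_Rhf (I : A -> Prop) : Prop :=
  closed_ideal I /\ hypofinite I /\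
  forall J, closed_ideal J -> hypofinite J -> forall x, J x -> I x.

End Defs.

(* Main.v *)
Require Import Defs.
From Stdlib Require Import Reals Lra Lia List Classical IndefiniteDescription.
From Coquelicot Require Import Complex Rbar Lub.

(* A finite rank operator on a normed space is compact, so hypofinite ideals are hypocompact.
   For the converse let K be a closed ideal of a hypocompact closed ideal I and let a be
   compact and non-zero modulo K.  Resolvents of self-adjoint elements of K form an
   approximate unit; it shows that K is a self-adjoint ideal of A and that the quotient
   seminorm q satisfies q(x)^2 <= q(x^* x).  Hence h = a^* a / q(a^* a) is compact modulo K,
   self-adjoint, and q(h^n) = 1 for all n.  By compactness of h some subsequence h^(N j)
   converges modulo K to an element y, necessarily non-zero, and h^(N (j + 10) - N j)
   subconverges to an element z = h w h.  Then y z = y = z y, so that the compact operator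
   x |-> z x z is the identity on the range of x |-> y x y, which by Riesz's theorem is
   finite-dimensional. *)

(* The algebra need not have a unit, and no spectral theory is used: every estimate must come from
   the C*-identity. This dictates resolvents at purely imaginary points. For self-adjoint [k] the
   element [S = k (k + i lam)^-1] satisfies [S^* S = Re S], and that alone makes [S] and [1 - S]
   contractive, without any order or positivity. Quotients are never formed: everything happens in
   [A], with equality replaced by [q (x - y) = 0]. Powers of [h] stand in for a spectral projection.
   Those parts of [h] with eigenvalue of modulus less than one die out, while the normalisation
   keeps the norm of every power equal to one, so a limit cannot vanish. A limit [y] of powers is
   not known to be idempotent; subtracting exponents provides the element [z] that acts on it as a
   unit. *)
Declare Scope alg_scope.
Delimit Scope alg_scope with A.
Bind Scope alg_scope with car.
Notation "0" := (zero _) : alg_scope.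
Notation "x + y" := (add _ x y) : alg_scope.
Notation "- x" := (opp _ x) : alg_scope.
Notation "x - y" := (add _ x (opp _ y)) : alg_scope.
Notation "x * y" := (mul _ x y) : alg_scope.
Notation "c *: x" := (scal _ c x) (at level 40) : alg_scope.
Notation "x ^*" := (star _ x) (at level 2, format "x ^*") : alg_scope.
Notation "⟦ x ⟧" := (norm _ x%A) (at level 0, x at level 99) : R_scope.

(** * Deciding identities of complex *-algebras *)

Section Reflection.
Variable A : CstarAlgebra.
Implicit Types x y z : A.

Lemma scal0 x : (RtoC 0 *: x)%A = 0%A.
Proof.
  set (z := (RtoC 0 *: x)%A).
  assert (H : (z + z = z)%A).
  { unfold z; rewrite <- scalDl; f_equal; ring. }
  rewrite <- (add0 A z), <- (addN A z), <- addA, (addC A (- z)%A), addA, H.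
  reflexivity.
Qed.

Lemma addr0 x : (x + 0)%A = x.
Proof. rewrite addC; apply add0. Qed.

Lemma opp_scal x : (- x)%A = (RtoC (-1) *: x)%A.
Proof.
  assert (H : (x + RtoC (-1) *: x)%A = 0%A).
  { rewrite <- (scal1 A x) at 1; rewrite <- scalDl, <- (scal0 x); f_equal.
    rewrite <- RtoC_plus; f_equal; ring. }
  rewrite <- (addr0 (- x)%A), <- H, addA, (addC A (- x)%A), addN.
  apply add0.
Qed.

Lemma scalr0 c : (c *: (0 : A))%A = 0%A.
Proof.
  rewrite <- (scal0 0%A) at 1; rewrite scalA.
  replace (c * 0)%C with (RtoC 0) by ring.
  apply scal0.
Qed.

Lemma mul0l x : (0 * x)%A = 0%A.
Proof. rewrite <- (scal0 0%A) at 1; rewrite <- scal_mull; apply scal0. Qed.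

Lemma mul0r x : (x * 0)%A = 0%A.
Proof. rewrite <- (scal0 0%A) at 1; rewrite <- scal_mulr; apply scal0. Qed.

Lemma star0 : ((0 : A)^*)%A = 0%A.
Proof.
  rewrite <- (scal0 0%A) at 1; rewrite star_scal.
  replace (Cconj 0) with (RtoC 0)
    by (apply injective_projections; simpl; ring).
  apply scal0.
Qed.

Inductive expr :=
  | EVar (n : nat)
  | EZero
  | EAdd (e f : expr)
  | EOpp (e : expr)
  | EMul (e f : expr)
  | EScal (c : C) (e : expr)
  | EStar (e : expr).

Inductive letter := Letter (n : nat) (starred : bool).
(* Words are non-empty because the algebra may lack a unit. *)
Inductive word := Last (l : letter) | Cons (l : letter) (w : word).
Inductive monomial := Mono (c : C) (w : word).

Variable env : list A.

Fixpoint eval (e : expr) : A :=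
  match e with
  | EVar n => nth n env 0%A
  | EZero => 0%A
  | EAdd e f => (eval e + eval f)%A
  | EOpp e => (- eval e)%A
  | EMul e f => (eval e * eval f)%A
  | EScal c e => (c *: eval e)%A
  | EStar e => ((eval e)^*)%A
  end.

Definition eval_letter (l : letter) : A :=
  match l with Letter n b => if b then ((nth n env 0)^*)%A else nth n env 0%A end.

Fixpoint eval_word (w : word) : A :=
  match w with
  | Last l => eval_letter l
  | Cons l w => (eval_letter l * eval_word w)%A
  end.

Fixpoint eval_poly (p : list monomial) : A :=
  match p with
  | nil => 0%A
  | Mono c w :: p => (c *: eval_word w + eval_poly p)%A
  end.

Fixpoint wcat (v w : word) : word :=
  match v with
  | Last l => Cons l w
  | Cons l v => Cons l (wcat v w)
  end.

(** A private append: [alg_step] unfolds the listed functions by name, and so unfolds no standard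
    function inside a coefficient. *)
Fixpoint pcat (p q : list monomial) : list monomial :=
  match p with
  | nil => q
  | m :: p => m :: pcat p q
  end.

Fixpoint pscal (c : C) (p : list monomial) : list monomial :=
  match p with
  | nil => nil
  | Mono d w :: p => Mono (Cmult c d) w :: pscal c p
  end.

Fixpoint mmul (c : C) (v : word) (q : list monomial) : list monomial :=
  match q with
  | nil => nil
  | Mono d w :: q => Mono (Cmult c d) (wcat v w) :: mmul c v q
  end.

Fixpoint pmul (p q : list monomial) : list monomial :=
  match p with
  | nil => nil
  | Mono c v :: p => pcat (mmul c v q) (pmul p q)
  end.

(* The boolean records whether the expression stands under a star. *)
Fixpoint flatten (b : bool) (e : expr) : list monomial :=
  match e with
  | EVar n => Mono (RtoC 1) (Last (Letter n b)) :: nil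
  | EZero => nil
  | EAdd e f => pcat (flatten b e) (flatten b f)
  | EOpp e => pscal (RtoC (-1)) (flatten b e)
  | EMul e f => if b then pmul (flatten b f) (flatten b e)
                else pmul (flatten b e) (flatten b f)
  | EScal c e => pscal (if b then Cconj c else c) (flatten b e)
  | EStar e => flatten (if b then false else true) e
  end.

Fixpoint eqn (m n : nat) : bool :=
  match m, n with
  | O, O => true
  | S m, S n => eqn m n
  | _, _ => false
  end.

Definition eql (k l : letter) : bool :=
  match k, l with
  | Letter m true, Letter n true => eqn m n
  | Letter m false, Letter n false => eqn m n
  | _, _ => false
  end.

Fixpoint eqw (v w : word) : bool :=
  match v, w with
  | Last k, Last l => eql k l
  | Cons k v, Cons l w => if eql k l then eqw v w else false
  | _, _ => false
  end.

Fixpoint insert (c : C) (v : word) (p : list monomial) : list monomial :=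
  match p with
  | nil => Mono c v :: nil
  | Mono d w :: p =>
      if eqw v w then Mono (Cplus c d) w :: p else Mono d w :: insert c v p
  end.

Fixpoint collect (p : list monomial) : list monomial :=
  match p with
  | nil => nil
  | Mono c v :: p => insert c v (collect p)
  end.

(** Equality of complex numbers is not decided by computation, so the vanishing of the coefficients
    stays a proposition; its conjuncts are the side goals that [alg] attacks. *)
Fixpoint null (p : list monomial) : Prop :=
  match p with
  | nil => True
  | Mono c _ :: p => c = RtoC 0 /\ null p
  end.

Lemma eval_wcat v w : eval_word (wcat v w) = (eval_word v * eval_word w)%A.
Proof. induction v; simpl; [reflexivity | rewrite IHv, mulA; reflexivity]. Qed.

Lemma eval_pcat p q : eval_poly (pcat p q) = (eval_poly p + eval_poly q)%A.
Proof.
  induction p as [|[c w] p IH]; simpl; [rewrite add0 | rewrite IH, addA]; reflexivity.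
Qed.

Lemma eval_pscal c p : eval_poly (pscal c p) = (c *: eval_poly p)%A.
Proof.
  induction p as [|[d w] p IH]; simpl; [rewrite scalr0; reflexivity|].
  rewrite IH, scalDr, scalA; reflexivity.
Qed.

Lemma eval_mmul c v q :
  eval_poly (mmul c v q) = ((c *: eval_word v) * eval_poly q)%A.
Proof.
  induction q as [|[d w] q IH]; simpl; [rewrite mul0r; reflexivity|].
  rewrite IH, mulDr, eval_wcat, <- scal_mulr, <- !scal_mull, !scalA.
  do 2 f_equal; ring.
Qed.

Lemma eval_pmul p q : eval_poly (pmul p q) = (eval_poly p * eval_poly q)%A.
Proof.
  induction p as [|[c v] p IH]; simpl; [rewrite mul0l; reflexivity|].
  rewrite eval_pcat, eval_mmul, IH, mulDl; reflexivity.
Qed.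

(** The flag varies in the induction because [EStar] flips it; under a star, [EMul] exchanges its
    factors. *)
Lemma eval_flatten e : forall b,
  eval_poly (flatten b e) = if b then ((eval e)^*)%A else eval e.
Proof.
  induction e; intros b; simpl.
  - rewrite scal1, addr0; reflexivity.
  - destruct b; [rewrite star0|]; reflexivity.
  - rewrite eval_pcat, IHe1, IHe2; destruct b; [rewrite star_add|]; reflexivity.
  - rewrite eval_pscal, IHe, !opp_scal; destruct b; [|reflexivity].
    rewrite star_scal; f_equal.
    apply injective_projections; simpl; ring.
  - destruct b; rewrite eval_pmul, IHe1, IHe2; [rewrite star_mul|]; reflexivity.
  - rewrite eval_pscal, IHe; destruct b; [rewrite star_scal|]; reflexivity.
  - rewrite IHe; destruct b; [rewrite star_invol|]; reflexivity.
Qed.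

Lemma eqn_eq m : forall n, eqn m n = true -> m = n.
Proof.
  induction m; destruct n; simpl; intros H; try discriminate; auto.
Qed.

Lemma eql_eq k l : eql k l = true -> k = l.
Proof.
  destruct k as [m []], l as [n []]; simpl; intros H; try discriminate;
    apply eqn_eq in H; subst; reflexivity.
Qed.

Lemma eqw_eq v : forall w, eqw v w = true -> v = w.
Proof.
  induction v as [k|k v IH]; destruct w as [l|l w]; simpl; intros H;
    try discriminate.
  - apply eql_eq in H; subst; reflexivity.
  - destruct (eql k l) eqn:E; [|discriminate].
    apply eql_eq in E; apply IH in H; subst; reflexivity.
Qed.

Lemma eval_insert c v p :
  eval_poly (insert c v p) = (c *: eval_word v + eval_poly p)%A.
Proof.
  induction p as [|[d w] p IH]; simpl; [reflexivity|].
  destruct (eqw v w) eqn:E; simpl.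
  - apply eqw_eq in E; subst; rewrite scalDl, addA; reflexivity.
  - rewrite IH, !addA, (addC A (d *: _)%A); reflexivity.
Qed.

Lemma eval_collect p : eval_poly (collect p) = eval_poly p.
Proof.
  induction p as [|[c v] p IH]; simpl; [|rewrite eval_insert, IH]; reflexivity.
Qed.

Lemma eval_null p : null p -> eval_poly p = 0%A.
Proof.
  induction p as [|[c v] p IH]; simpl; [reflexivity|].
  intros [-> H]; rewrite scal0, add0; auto.
Qed.

Lemma sub_eq0 x y : (x - y)%A = 0%A -> x = y.
Proof.
  intros H.
  rewrite <- (add0 A y), <- H, <- addA, (addC A (- y)%A), addN, addr0.
  reflexivity.
Qed.

Lemma eval_eq e f : null (collect (flatten false (EAdd e (EOpp f)))) -> eval e = eval f.
Proof.
  intros H; apply sub_eq0.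
  change (eval (EAdd e (EOpp f)) = 0%A).
  rewrite <- (eval_flatten _ false), <- eval_collect.
  apply eval_null; exact H.
Qed.
End Reflection.

Ltac index x l :=
  lazymatch l with
  | x :: _ => constr:(O)
  | _ :: ?l => let n := index x l in constr:(S n)
  end.

Ltac add_atom x l :=
  match l with
  | context [x :: _] => constr:(l)
  | _ => constr:(x :: l)
  end.

Ltac atoms e l :=
  lazymatch e with
  | zero _ => constr:(l)
  | add _ ?a ?b => let l := atoms a l in atoms b l
  | mul _ ?a ?b => let l := atoms a l in atoms b l
  | opp _ ?a => atoms a l
  | scal _ _ ?a => atoms a l
  | star _ ?a => atoms a l
  | _ => add_atom e l
  end.

Ltac reify e l :=
  lazymatch e with
  | zero _ => constr:(EZero)
  | add _ ?a ?b => let a := reify a l in let b := reify b l in constr:(EAdd a b)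
  | mul _ ?a ?b => let a := reify a l in let b := reify b l in constr:(EMul a b)
  | opp _ ?a => let a := reify a l in constr:(EOpp a)
  | scal _ ?c ?a => let a := reify a l in constr:(EScal c a)
  | star _ ?a => let a := reify a l in constr:(EStar a)
  | _ => let n := index e l in constr:(EVar n)
  end.

Ltac alg_step :=
  lazymatch goal with
  | |- ?x = ?y :> car ?A =>
      let l := atoms x (@nil (car A)) in
      let l := atoms y l in
      let e := reify x l in
      let f := reify y l in
      change (eval A l e = eval A l f);
      apply eval_eq;
      cbv beta iota zeta delta
        [collect insert eqw eql eqn flatten pcat pscal pmul mmul wcat null];
      repeat match goal with
      | |- _ /\ _ => split
      | |- True => exact I
      end
  end.

(* Identities of *-algebras reduce to identities between complex coefficients. *)
Ltac alg :=
  alg_step;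
  try ring;
  apply injective_projections; simpl; try field; try lra.

(** The number [i r], written as a pair so that the projections taken by [alg] compute. *)
Notation imag r := (@pair R R (IZR Z0) r%R).

(** * Resolvents of self-adjoint elements *)

Section Cstar.
Variable A : CstarAlgebra.
Implicit Types x y k m S : A.

Lemma norm0 : ⟦(0 : A)⟧ = 0.
Proof. rewrite <- (scal0 A 0%A), norm_scal, Cmod_0; ring. Qed.

Lemma norm_opp x : ⟦- x⟧ = ⟦x⟧.
Proof.
  rewrite opp_scal, norm_scal, Cmod_R, Rabs_left by lra; ring.
Qed.

Lemma norm_ge0 x : 0 <= ⟦x⟧.
Proof.
  pose proof (norm_triangle A x (- x)%A) as H.
  rewrite addN, norm0, norm_opp in H; lra.
Qed.

Lemma norm_sub_le x y : ⟦x - y⟧ <= ⟦x⟧ + ⟦y⟧.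
Proof. rewrite <- (norm_opp y); apply norm_triangle. Qed.

Lemma norm_subC x y : ⟦x - y⟧ = ⟦y - x⟧.
Proof.
  rewrite <- (norm_opp (x - y)); f_equal; alg.
Qed.

Lemma norm_small_eq0 x : (forall eps, 0 < eps -> ⟦x⟧ < eps) -> x = 0%A.
Proof.
  intros H; apply norm_eq0.
  destruct (norm_ge0 x) as [Hx|Hx]; [|auto].
  specialize (H _ Hx); lra.
Qed.

Lemma norm_star x : ⟦x^*⟧ = ⟦x⟧.
Proof.
  assert (H : forall y : A, ⟦y⟧ <= ⟦y^*⟧).
  { intros y.
    pose proof (norm_mul A (y^*)%A y) as H; rewrite cstar_id in H.
    pose proof (norm_ge0 y); pose proof (norm_ge0 (y^*)%A).
    destruct (Req_dec ⟦y⟧ 0); [lra|].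
    apply Rmult_le_reg_r with ⟦y⟧; lra. }
  apply Rle_antisym; [|apply H].
  pose proof (H (x^*)%A) as H'; rewrite star_invol in H'; exact H'.
Qed.

(** The contraction principle, in place of a Neumann series. The closed predicate [P] carries a
    property of the iterates to the limit; it will be commutation with [k]. *)
Lemma affine_fixpoint (b : A) (L : A -> A) (theta : R) (P : A -> Prop) :
  0 <= theta < 1 ->
  (forall x y, L (x - y)%A = (L x - L y)%A) ->
  (forall x, ⟦L x⟧ <= theta * ⟦x⟧) ->
  is_closed A P -> P 0%A -> (forall x, P x -> P (b + L x)%A) ->
  exists s, P s /\ s = (b + L s)%A.
Proof.
  intros Ht Llin Lnorm Pc P0 PL.
  set (u := fun n => Nat.iter n (fun x => b + L x)%A 0%A).
  (* [D] is the fixed point of [r |-> ⟦b⟧ + theta * r], hence a bound for all iterates. *)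
  set (D := ⟦b⟧ / (1 - theta)).
  assert (HD : ⟦b⟧ + theta * D = D) by (unfold D; field; lra).
  assert (D0 : 0 <= D).
  { apply Rmult_le_pos; [apply norm_ge0|].
    apply Rlt_le, Rinv_0_lt_compat; lra. }
  assert (ub : forall p, ⟦u p⟧ <= D).
  { induction p as [|p IH]; [simpl; rewrite norm0; exact D0|].
    change (u (Datatypes.S p)) with (b + L (u p))%A.
    eapply Rle_trans; [apply norm_triangle|].
    pose proof (Lnorm (u p)).
    assert (theta * ⟦u p⟧ <= theta * D) by (apply Rmult_le_compat_l; lra).
    lra. }
  (* The difference is [L] applied [n] times to [u p]. *)
  assert (ud : forall n p, ⟦u (n + p)%nat - u n⟧ <= theta ^ n * D).
  { induction n as [|n IH]; intros p; simpl.
    - replace (u p - 0)%A with (u p) by alg.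
      rewrite Rmult_1_l; apply ub.
    - replace (b + L (u (n + p)%nat) - (b + L (u n)))%A
        with (L (u (n + p)%nat - u n)%A) by (rewrite Llin; alg).
      eapply Rle_trans; [apply Lnorm|].
      rewrite Rmult_assoc; apply Rmult_le_compat_l; [lra|apply IH]. }
  assert (uc : forall eps, 0 < eps -> exists N, forall m n : nat, (N <= m)%nat ->
    (N <= n)%nat -> ⟦u m - u n⟧ < eps).
  { intros eps Heps.
    destruct (pow_lt_1_zero theta) with (y := eps / (D + 1)) as [N HN].
    - rewrite Rabs_right; lra.
    - apply Rdiv_lt_0_compat; lra.
    - assert (W : forall n p, (N <= n)%nat -> ⟦u (n + p)%nat - u n⟧ < eps).
      { intros n p Hn.
        eapply Rle_lt_trans; [apply ud|].
        specialize (HN n Hn).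
        rewrite Rabs_right in HN by (apply Rle_ge, pow_le; lra).
        apply Rle_lt_trans with (theta ^ n * (D + 1)).
        - apply Rmult_le_compat_l; [apply pow_le|]; lra.
        - apply Rmult_lt_reg_r with (/ (D + 1)); [apply Rinv_0_lt_compat; lra|].
          rewrite Rmult_assoc, Rinv_r, Rmult_1_r by lra; exact HN. }
      exists N; intros m n Hm Hn.
      destruct (Nat.le_ge_cases n m).
      + replace m with (n + (m - n))%nat by lia; auto.
      + rewrite norm_subC; replace n with (m + (n - m))%nat by lia; auto. }
  destruct (complete A u uc) as [s Hs].
  exists s; split.
  - apply (Pc u); [|exact Hs].
    induction n as [|n IH]; [exact P0|apply PL, IH].
  - apply sub_eq0, norm_small_eq0; intros eps Heps.
    destruct (Hs (eps / 2)) as [N HN]; [lra|].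
    replace (s - (b + L s))%A with (- (u (Datatypes.S N) - s) + L (u N - s))%A
      by (rewrite Llin; simpl; alg).
    eapply Rle_lt_trans; [apply norm_triangle|]; rewrite norm_opp.
    pose proof (HN N (Nat.le_refl _)).
    pose proof (HN (Datatypes.S N) (Nat.le_succ_diag_r _)).
    pose proof (Lnorm (u N - s)%A).
    assert (theta * ⟦u N - s⟧ <= 1 * ⟦u N - s⟧)
      by (apply Rmult_le_compat_r; [apply norm_ge0|lra]).
    lra.
Qed.

(* [S = k (k + i lam)^-1], so that [1 - S = i lam (k + i lam)^-1] in the unitization. *)
Definition resolves k (lam : R) S : Prop :=
  (k * S + imag lam *: S)%A = k /\ (S * k)%A = (k * S)%A.

Lemma resolves_mul_l k lam S : resolves k lam S -> (k * S)%A = (k - imag lam *: S)%A.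
Proof. intros [H _]; rewrite <- H at 2; alg. Qed.

Lemma resolves_star k lam S :
  (k^*)%A = k -> resolves k lam S -> resolves k (- lam) (S^*)%A.
Proof.
  intros Hk [H1 H2].
  apply (f_equal (star A)) in H2; rewrite !star_mul, Hk in H2.
  split; [|auto].
  rewrite H2, <- Hk at 1.
  replace (S^* * k^* + imag (- lam) *: S^*)%A with ((k * S + imag lam *: S)^*)%A by alg.
  rewrite H1; auto.
Qed.

(** For a real number [k], the quotient [k / (k + i lam)] lies on the circle with diameter [[0, 1]],
    where [|S|^2 = Re S]. *)
Lemma resolves_star_mul k lam S :
  (k^*)%A = k -> lam <> 0 -> resolves k lam S ->
  (S^* * S)%A = (RtoC (1 / 2) *: (S + S^*))%A.
Proof.
  intros Hk Hlam H.
  pose proof (resolves_mul_l _ _ _ H) as E.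
  pose proof (resolves_star _ _ _ Hk H) as H'.
  assert (E' : (S^* * k)%A = (k - imag (- lam) *: S^*)%A).
  { rewrite (proj2 H'); apply resolves_mul_l; exact H'. }
  pose proof (mulA A (S^*)%A k S) as F.
  rewrite E, E', mulDr, mulDl, E, E' in F.
  match type of F with ?P = ?Q =>
    transitivity (RtoC (1 / 2) *: (S + S^*) + imag (1 / (2 * lam)) *: (P - Q))%A
  end.
  - alg.
  - rewrite F; alg.
Qed.

Lemma resolves_norm_le k lam S :
  (k^*)%A = k -> lam <> 0 -> resolves k lam S -> ⟦S⟧ <= 1.
Proof.
  intros Hk Hlam H.
  pose proof (cstar_id A S) as E.
  rewrite (resolves_star_mul _ _ _ Hk Hlam H), norm_scal, Cmod_R, Rabs_right in E by lra.
  pose proof (norm_triangle A S (S^*)%A) as T; rewrite norm_star in T.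
  pose proof (norm_ge0 S).
  destruct (Req_dec ⟦S⟧ 0); [lra|].
  apply Rmult_le_reg_r with ⟦S⟧; lra.
Qed.

(** From [S^* S = Re S] also [(1 - S)^* (1 - S) = Re (1 - S)]. So [t = (1 - S) y] satisfies
    [t^* t = Re (y^* t)], and the C*-identity gives [⟦t⟧^2 <= ⟦y⟧ ⟦t⟧]. *)
Lemma resolves_contract_l k lam S y :
  (k^*)%A = k -> lam <> 0 -> resolves k lam S -> ⟦y - S * y⟧ <= ⟦y⟧.
Proof.
  intros Hk Hlam H.
  set (t := (y - S * y)%A).
  assert (E : (t^* * t)%A = (RtoC (1 / 2) *: (y^* * t + t^* * y))%A).
  { transitivity (y^* * y - y^* * S * y - y^* * S^* * y + y^* * (S^* * S) * y)%A.
    - unfold t; alg.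
    - rewrite (resolves_star_mul _ _ _ Hk Hlam H); unfold t; alg. }
  apply (f_equal (norm A)) in E.
  rewrite cstar_id, norm_scal, Cmod_R, Rabs_right in E by lra.
  pose proof (norm_triangle A (y^* * t)%A (t^* * y)%A) as T.
  pose proof (norm_mul A (y^*)%A t) as M1.
  pose proof (norm_mul A (t^*)%A y) as M2.
  rewrite norm_star in M1, M2.
  pose proof (norm_ge0 t); pose proof (norm_ge0 y).
  destruct (Req_dec ⟦t⟧ 0); [lra|].
  apply Rmult_le_reg_r with ⟦t⟧; lra.
Qed.

Lemma resolves_contract_r k lam S y :
  (k^*)%A = k -> lam <> 0 -> resolves k lam S -> ⟦y - y * S⟧ <= ⟦y⟧.
Proof.
  intros Hk Hlam H.
  rewrite <- (norm_star (y - y * S)), <- (norm_star y).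
  replace ((y - y * S)^*)%A with (y^* - S^* * y^*)%A by alg.
  apply resolves_contract_l with k (- lam); auto using resolves_star; lra.
Qed.

Lemma closed_commutant k : is_closed A (fun s => (s * k)%A = (k * s)%A).
Proof.
  intros u l Hu Hl; apply sub_eq0, norm_small_eq0; intros eps Heps.
  pose proof (norm_ge0 k) as Hk.
  destruct (Hl (eps / (2 * (⟦k⟧ + 1)))) as [N HN].
  { apply Rdiv_lt_0_compat; lra. }
  specialize (HN N (Nat.le_refl _)).
  replace (l * k - k * l)%A
    with (k * (u N - l) - (u N - l) * k + (u N * k - k * u N))%A by alg.
  rewrite Hu, addN, addr0.
  eapply Rle_lt_trans; [apply norm_sub_le|].
  pose proof (norm_mul A k (u N - l)%A).
  pose proof (norm_mul A (u N - l)%A k).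
  set (d := ⟦u N - l⟧) in *.
  assert (d * (2 * (⟦k⟧ + 1)) < eps).
  { apply Rmult_lt_reg_r with (/ (2 * (⟦k⟧ + 1))); [apply Rinv_0_lt_compat; lra|].
    rewrite Rmult_assoc, Rinv_r, Rmult_1_r by lra; exact HN. }
  assert (0 <= d) by apply norm_ge0.
  lra.
Qed.

(** Solved for its second term, the equation reads [S = (k - k S) / (i lam)], a contraction of ratio
    [⟦k⟧ / lam]. *)
Lemma resolves_large k lam : ⟦k⟧ < lam -> exists S, resolves k lam S.
Proof.
  intros Hlam; pose proof (norm_ge0 k) as Hk.
  destruct (affine_fixpoint (imag (- / lam) *: k)%A (fun s => imag (/ lam) *: (k * s))%A
    (⟦k⟧ / lam) (fun s => (s * k)%A = (k * s)%A)) as [S [HS E]].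
  - split; [apply Rmult_le_pos; [lra|apply Rlt_le, Rinv_0_lt_compat; lra]|].
    apply Rmult_lt_reg_r with lam; [lra|].
    unfold Rdiv; rewrite Rmult_assoc, Rinv_l by lra; lra.
  - intros x y; alg.
  - intros x; rewrite norm_scal.
    replace (Cmod (imag (/ lam))) with (/ lam).
    + unfold Rdiv; rewrite (Rmult_comm ⟦k⟧), Rmult_assoc.
      apply Rmult_le_compat_l; [apply Rlt_le, Rinv_0_lt_compat; lra|apply norm_mul].
    + unfold Cmod; simpl.
      replace (_ + _) with (Rsqr (/ lam)) by (unfold Rsqr; ring).
      rewrite sqrt_Rsqr; [reflexivity|apply Rlt_le, Rinv_0_lt_compat; lra].
  - apply closed_commutant.
  - alg.
  - intros s Hs.
    transitivity (imag (- / lam) *: (k * k) + imag (/ lam) *: (k * (s * k)))%A; [alg|].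
    rewrite Hs; alg.
  - exists S; split; [|exact HS].
    transitivity (k * S + imag lam *: (imag (- / lam) *: k + imag (/ lam) *: (k * S)))%A.
    + rewrite <- E; reflexivity.
    + alg.
Qed.

(** The resolvent identity between [lam] and [lam / 2] is [S' = S + (1 / 2) (1 - S) S']. As [1 - S]
    is contractive, the ratio is [1 / 2] whatever [lam] is, so halving can be repeated forever. *)
Lemma resolves_half k lam S :
  (k^*)%A = k -> lam <> 0 -> resolves k lam S -> exists S', resolves k (lam / 2) S'.
Proof.
  intros Hk Hlam H.
  destruct (affine_fixpoint S (fun s => RtoC (1 / 2) *: (s - S * s))%A
    (1 / 2) (fun s => (s * k)%A = (k * s)%A)) as [S' [HS E]].
  - lra.
  - intros x y; alg.
  - intros x; rewrite norm_scal, Cmod_R, Rabs_right by lra.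
    apply Rmult_le_compat_l; [lra|].
    apply resolves_contract_l with k lam; auto.
  - apply closed_commutant.
  - alg.
  - intros s Hs.
    transitivity (S * k + RtoC (1 / 2) *: (s * k - S * (s * k)))%A; [alg|].
    rewrite Hs.
    transitivity (S * k + RtoC (1 / 2) *: (k * s - (S * k) * s))%A; [alg|].
    rewrite (proj2 H); alg.
  - exists S'; split; [|exact HS].
    set (F := (S + RtoC (1 / 2) *: (S' - S * S'))%A) in E.
    transitivity (k * F + imag (lam / 2) *: S')%A; [rewrite <- E; reflexivity|].
    transitivity (imag (lam / 2) *: S'
      + (k * S + RtoC (1 / 2) *: (k * S' - (k * S) * S')))%A; [unfold F; alg|].
    rewrite (resolves_mul_l _ _ _ H).
    (* The product [k * S'] cancels; only the defect [S' - F] of the fixed point equation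
       remains. *)
    transitivity (k + imag lam *: (S' - F))%A; [unfold F; alg|].
    rewrite <- E; alg.
Qed.

Lemma resolves_small k eps :
  (k^*)%A = k -> 0 < eps -> exists lam S, 0 < lam < eps /\ resolves k lam S.
Proof.
  intros Hk Heps; pose proof (norm_ge0 k).
  set (lam := fun n => (⟦k⟧ + 1) * (/ 2) ^ n).
  assert (Hlam : forall n, 0 < lam n).
  { intros n; apply Rmult_lt_0_compat; [|apply pow_lt]; lra. }
  assert (W : forall n, exists S, resolves k (lam n) S).
  { induction n as [|n [S HS]].
    - apply resolves_large; unfold lam; simpl; lra.
    - replace (lam (Datatypes.S n)) with (lam n / 2) by (unfold lam; simpl; field).
      specialize (Hlam n).
      apply resolves_half with S; auto; lra. }
  destruct (pow_lt_1_zero (/ 2)) with (y := eps / (⟦k⟧ + 1)) as [N HN].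
  - rewrite Rabs_right; lra.
  - apply Rdiv_lt_0_compat; lra.
  - destruct (W N) as [S HS].
    exists (lam N), S; repeat split; auto; try apply HS.
    specialize (HN N (Nat.le_refl _)).
    rewrite Rabs_right in HN by (apply Rle_ge, pow_le; lra).
    unfold lam; rewrite Rmult_comm.
    apply Rmult_lt_reg_r with (/ (⟦k⟧ + 1)); [apply Rinv_0_lt_compat; lra|].
    rewrite Rmult_assoc, Rinv_r, Rmult_1_r by lra; exact HN.
Qed.

(* The elements [S] play the role of an approximate unit of any ideal containing [m]. *)
Lemma approximate_unit x m eps : (m^*)%A = m -> 0 < eps ->
  exists lam S, lam <> 0 /\ resolves m lam S /\
    ⟦x - x * S⟧ * ⟦x - x * S⟧ <= ⟦x^* * x - m⟧ + eps.
Proof.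
  intros Hm Heps.
  destruct (resolves_small m eps Hm Heps) as [lam [S [Hlam HS]]].
  assert (Hl : lam <> 0) by lra.
  assert (Hl' : - lam <> 0) by lra.
  pose proof (resolves_star _ _ _ Hm HS) as HS'.
  exists lam, S; repeat split; auto; try apply HS.
  rewrite <- cstar_id.
  set (w := (x^* * x - m)%A).
  set (v := (w - S^* * w)%A).
  set (t := (imag lam *: S)%A).
  replace ((x - x * S)^* * (x - x * S))%A with ((v - v * S) + (t - S^* * t))%A.
  2: { transitivity ((x - x * S)^* * (x - x * S)
         + (t - (m - m * S)) - S^* * (t - (m - m * S)))%A.
       - unfold v, w, t; alg.
       - rewrite (resolves_mul_l _ _ _ HS); unfold t; alg. }
  eapply Rle_trans; [apply norm_triangle|].
  apply Rplus_le_compat.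
  - eapply Rle_trans; [apply resolves_contract_r with m lam; auto|].
    apply resolves_contract_l with m (- lam); auto.
  - eapply Rle_trans; [apply resolves_contract_l with m (- lam); auto|].
    unfold t; rewrite norm_scal.
    replace (Cmod (imag lam)) with lam.
    + pose proof (resolves_norm_le _ _ _ Hm Hl HS).
      apply Rle_trans with (lam * 1); [apply Rmult_le_compat_l|]; lra.
    + unfold Cmod; simpl.
      replace (_ + _) with (Rsqr lam) by (unfold Rsqr; ring).
      rewrite sqrt_Rsqr; lra.
Qed.

(** * Closed ideals *)

Lemma closed_approx (P : A -> Prop) x : is_closed A P ->
  (forall eps, 0 < eps -> exists y, P y /\ ⟦x - y⟧ < eps) -> P x.
Proof.
  intros Pc H.
  destruct (functional_choice (fun n y => P y /\ ⟦x - y⟧ < / INR (n + 1))) as [u Hu].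
  { intros n; apply H, Rinv_0_lt_compat, lt_0_INR; lia. }
  apply (Pc u); [apply Hu|].
  intros eps Heps.
  destruct (archimed_cor1 eps Heps) as [N [HN HN0]].
  exists N; intros n Hn.
  rewrite norm_subC; eapply Rlt_trans; [apply Hu|].
  eapply Rle_lt_trans; [|exact HN].
  apply Rinv_le_contravar; [apply lt_0_INR; lia|apply le_INR; lia].
Qed.

Lemma whole_ideal : is_ideal_in A (whole A) (whole A).
Proof. repeat split. Qed.

Lemma ideal_sub (I K : A -> Prop) x y :
  is_ideal_in A I K -> K x -> K y -> K (x - y)%A.
Proof. intros [_ [_ [Ka [Ko _]]]] Hx Hy; auto. Qed.

(** The resolvent equation gives [S = (m - m S) / (i lam)], and [m S] is in [K] as soon as [S] is in
    [I]. *)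
Lemma resolves_mem (I K : A -> Prop) m lam S :
  is_ideal_in A I K -> K m -> I S -> lam <> 0 -> resolves m lam S -> K S.
Proof.
  intros IK Km IS Hlam H.
  replace S with (imag (- / lam) *: (m - m * S))%A.
  - pose proof IK as [_ [_ [_ [_ [Ks Km']]]]].
    apply Ks, ideal_sub with I; auto.
    apply Km'; auto.
  - rewrite (resolves_mul_l _ _ _ H); alg.
Qed.

(** * Ideals of a self-adjoint ideal *)

Section SubIdeal.
Variables I K : A -> Prop.
Hypothesis I_ideal : is_ideal_in A (whole A) I.
Hypothesis I_star : forall x, I x -> I (x^*)%A.
Hypothesis K_ideal : is_ideal_in A I K.
Hypothesis K_closed : is_closed A K.

(** The approximate unit is built from [m = x^* x], which makes the distance [⟦x^* x - m⟧] zero. The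
    adjoint of [S] is in [K] because it is the resolvent at [- lam]. *)
Lemma sub_ideal_unit x eps : K x -> 0 < eps ->
  exists S, K S /\ K (S^*)%A /\ ⟦x - x * S⟧ < eps.
Proof.
  intros Kx Heps.
  pose proof K_ideal as [KI [_ [_ [_ [_ Km]]]]].
  set (h := (x^* * x)%A).
  assert (Hh : (h^*)%A = h) by (unfold h; alg).
  assert (Kh : K h) by (apply (Km (x^*)%A x); auto).
  destruct (approximate_unit x h (eps * eps / 2) Hh) as [lam [S [Hlam [HS E]]]].
  { assert (0 < eps * eps) by (apply Rmult_lt_0_compat; auto); lra. }
  unfold h at 1 in E; rewrite addN, norm0 in E.
  assert (mem : forall l T, l <> 0 -> resolves h l T -> K T).
  { intros l T Hl HT.
    (* Membership climbs down in two stages: first [T] is in [I], as an ideal of [A], then in [K],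
       as an ideal of [I]. *)
    apply resolves_mem with I h l; auto.
    apply resolves_mem with (whole A) h l; auto; exact Logic.I. }
  exists S; repeat split.
  - eapply mem; eauto.
  - apply mem with (- lam); [lra|apply resolves_star; auto].
  - pose proof (norm_ge0 (x - x * S)%A).
    apply Rnot_le_lt; intros Hn.
    assert (eps * eps <= ⟦x - x * S⟧ * ⟦x - x * S⟧) by (apply Rmult_le_compat; lra).
    assert (0 < eps * eps) by (apply Rmult_lt_0_compat; auto).
    lra.
Qed.

(** The adjoint is a limit of products [S^* x^*], with [S^*] in [K] and [x^*] in [I]. *)
Lemma sub_ideal_star x : K x -> K (x^*)%A.
Proof.
  intros Kx; apply closed_approx; auto; intros eps Heps.
  pose proof K_ideal as [KI [_ [_ [_ [_ Km]]]]].
  destruct (sub_ideal_unit x eps Kx Heps) as [S [_ [KS E]]].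
  exists (S^* * x^*)%A; split; [apply Km; auto|].
  replace (x^* - S^* * x^*)%A with ((x - x * S)^*)%A by alg.
  rewrite norm_star; exact E.
Qed.

(** Here [x] is arbitrary in [A]; inserting [S] helps because [S x] lies in [I], so that [k (S x)]
    lies in [K]. *)
Lemma sub_ideal_mul_r x k : K k -> K (k * x)%A.
Proof.
  intros Kk; apply closed_approx; auto; intros eps Heps.
  pose proof K_ideal as [KI [_ [_ [_ [_ Km]]]]].
  pose proof (norm_ge0 x).
  destruct (sub_ideal_unit k (eps / (⟦x⟧ + 1)) Kk) as [S [KS [_ E]]].
  { apply Rdiv_lt_0_compat; lra. }
  exists (k * (S * x))%A; split.
  - apply Km; auto; apply I_ideal; [exact Logic.I|auto].
  - replace (k * x - k * (S * x))%A with ((k - k * S) * x)%A by alg.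
    eapply Rle_lt_trans; [apply norm_mul|].
    pose proof (norm_ge0 (k - k * S)%A).
    apply Rle_lt_trans with (⟦k - k * S⟧ * (⟦x⟧ + 1)); [apply Rmult_le_compat_l; lra|].
    apply Rmult_lt_reg_r with (/ (⟦x⟧ + 1)); [apply Rinv_0_lt_compat; lra|].
    rewrite Rmult_assoc, Rinv_r, Rmult_1_r by lra; exact E.
Qed.

Lemma sub_ideal_closed_ideal : closed_ideal A K.
Proof.
  split; [|exact K_closed].
  pose proof K_ideal as [KI [K0 [Ka [Ko [Ks Km]]]]].
  split; [intros; exact Logic.I|].
  do 4 (split; [assumption|]).
  intros x k _ Kk; split; [|apply sub_ideal_mul_r; exact Kk].
  replace (x * k)%A with ((k^* * x^*)^*)%A by alg.
  apply sub_ideal_star, sub_ideal_mul_r, sub_ideal_star; exact Kk.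
Qed.
End SubIdeal.

Lemma closed_ideal_star (I : A -> Prop) x : closed_ideal A I -> I x -> I (x^*)%A.
Proof.
  intros [HI HIc].
  apply sub_ideal_star with (whole A); auto using whole_ideal.
Qed.
End Cstar.

(** * Subsequences *)

Definition nat_increasing (phi : nat -> nat) : Prop := forall n, (phi n < phi (S n))%nat.

Lemma increasing_lt phi i j : nat_increasing phi -> (i < j)%nat -> (phi i < phi j)%nat.
Proof.
  intros Hphi; induction 1 as [|j _ IH]; [apply Hphi|].
  specialize (Hphi j); lia.
Qed.

Lemma increasing_ge phi n : nat_increasing phi -> (n <= phi n)%nat.
Proof.
  intros Hphi; induction n as [|n IH]; [lia|].
  specialize (Hphi n); lia.
Qed.

Lemma increasing_comp phi psi :
  nat_increasing phi -> nat_increasing psi -> nat_increasing (fun n => phi (psi n)).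
Proof. intros Hphi Hpsi n; apply increasing_lt; auto. Qed.

Lemma increasing_extraction (P : nat -> nat -> Prop) :
  (forall j N : nat, exists p, (N <= p)%nat /\ P j p) ->
  exists phi, nat_increasing phi /\ forall j, P j (phi j).
Proof.
  intros H.
  destruct (functional_choice (fun jN p => (snd jN <= p)%nat /\ P (fst jN) p))
    as [f Hf]; [intros [j N]; apply H|].
  set (phi := fix phi j := match j with
    | O => f (O, O)
    | S i => f (S i, S (phi i))
    end).
  exists phi; split.
  - intros n; apply (Hf (S n, S (phi n))).
  - intros [|j]; [apply (Hf (O, O))|apply (Hf (S j, S (phi j)))].
Qed.

Lemma bounded_subsequence_R (u : nat -> R) M : (forall n, Rabs (u n) <= M) ->
  exists phi, nat_increasing phi /\ exists l, Un_cv (fun n => u (phi n)) l.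
Proof.
  intros HM.
  destruct (Bolzano_Weierstrass u (fun c => - M <= c <= M)) as [l Hl].
  - apply compact_P3.
  - intros n; specialize (HM n); unfold Rabs in HM; destruct (Rcase_abs (u n)); lra.
  - destruct (increasing_extraction (fun j p => Rabs (u p - l) < / INR (j + 1)))
      as [phi [Hphi E]].
    + intros j N.
      assert (Hj : 0 < / INR (j + 1)) by (apply Rinv_0_lt_compat, lt_0_INR; lia).
      apply (Hl (disc l (mkposreal _ Hj)) N).
      exists (mkposreal _ Hj); intros z Hz; exact Hz.
    + exists phi; split; [exact Hphi|exists l].
      intros eps Heps.
      destruct (archimed_cor1 eps Heps) as [N [HN HN0]].
      exists N; intros n Hn.
      eapply Rlt_trans; [apply E|].
      eapply Rle_lt_trans; [|exact HN].
      apply Rinv_le_contravar; [apply lt_0_INR; lia|apply le_INR; lia].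
Qed.

Lemma Cmod_le_Re_Im (z : C) : Cmod z <= Rabs (fst z) + Rabs (snd z).
Proof.
  replace z with (RtoC (fst z) + Ci * RtoC (snd z))%C at 1
    by (apply injective_projections; simpl; ring).
  eapply Rle_trans; [apply Cmod_triangle|].
  rewrite Cmod_mult, Cmod_Ci, !Cmod_R; lra.
Qed.

Lemma bounded_subsequence_C (u : nat -> C) M : (forall n, Cmod (u n) <= M) ->
  exists phi, nat_increasing phi /\ exists l, forall eps, 0 < eps ->
    exists N, forall n, (N <= n)%nat -> Cmod (u (phi n) - l)%C < eps.
Proof.
  intros HM.
  assert (HM' : forall n, Rabs (fst (u n)) <= M /\ Rabs (snd (u n)) <= M).
  { intros n; specialize (HM n); pose proof (Rmax_Cmod (u n)) as H.
    split; (eapply Rle_trans; [|exact HM]); (eapply Rle_trans; [|exact H]);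
      [apply Rmax_l|apply Rmax_r]. }
  destruct (bounded_subsequence_R (fun n => fst (u n)) M) as [phi [Hphi [a Ha]]];
    [apply HM'|].
  destruct (bounded_subsequence_R (fun n => snd (u (phi n))) M) as [psi [Hpsi [b Hb]]];
    [intros n; apply HM'|].
  exists (fun n => phi (psi n)); split; [apply increasing_comp; auto|].
  exists (a, b); intros eps Heps.
  destruct (Ha (eps / 2)) as [N1 H1]; [lra|].
  destruct (Hb (eps / 2)) as [N2 H2]; [lra|].
  exists (N1 + N2)%nat; intros n Hn.
  eapply Rle_lt_trans; [apply Cmod_le_Re_Im|].
  pose proof (increasing_ge psi n Hpsi).
  specialize (H1 (psi n)); specialize (H2 n).
  unfold Rdist in H1, H2; simpl.
  unfold Rminus in H1, H2.
  assert (G1 := H1 ltac:(lia)); assert (G2 := H2 ltac:(lia)); lra.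
Qed.

(** * Finite-dimensional subspaces for a seminorm *)

Section Seminorm.
Variable A : CstarAlgebra.
Variable q : A -> R.
Hypothesis q_add : forall x y, q (x + y)%A <= q x + q y.
Hypothesis q_scal : forall c x, q (c *: x)%A = Cmod c * q x.
Implicit Types x l : A.

Definition converges (u : nat -> A) l : Prop :=
  forall eps, 0 < eps -> exists N, forall n, (N <= n)%nat -> q (u n - l)%A < eps.

Lemma q0 : q 0%A = 0.
Proof. rewrite <- (scal0 A 0%A), q_scal, Cmod_0; ring. Qed.

Lemma q_opp x : q (- x)%A = q x.
Proof.
  rewrite opp_scal, q_scal, Cmod_R, Rabs_left by lra; ring.
Qed.

Lemma q_ge0 x : 0 <= q x.
Proof.
  pose proof (q_add x (- x)%A) as H; rewrite addN, q0, q_opp in H; lra.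
Qed.

Lemma q_subC x y : q (x - y)%A = q (y - x)%A.
Proof. rewrite <- q_opp; f_equal; alg. Qed.

Lemma q_sub_triangle x y z : q (x - z)%A <= q (x - y)%A + q (y - z)%A.
Proof.
  replace (x - z)%A with (x - y + (y - z))%A by alg; apply q_add.
Qed.

Lemma q_le_sub x y : q x <= q y + q (x - y)%A.
Proof.
  replace x with (y + (x - y))%A at 1 by alg; apply q_add.
Qed.

Lemma converges_subseq u l phi :
  nat_increasing phi -> converges u l -> converges (fun n => u (phi n)) l.
Proof.
  intros Hphi H eps Heps; destruct (H eps Heps) as [N HN].
  exists N; intros n Hn; apply HN.
  pose proof (increasing_ge phi n Hphi); lia.
Qed.

Lemma converges_lipschitz u v l m M : (forall n, q (v n - m)%A <= M * q (u n - l)%A) ->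
  converges u l -> converges v m.
Proof.
  intros HM H eps Heps.
  destruct (H (eps / (Rabs M + 1))) as [N HN].
  { apply Rdiv_lt_0_compat; pose proof (Rabs_pos M); lra. }
  exists N; intros n Hn.
  eapply Rle_lt_trans; [apply HM|].
  pose proof (q_ge0 (u n - l)%A); pose proof (Rabs_pos M); pose proof (Rle_abs M).
  apply Rle_lt_trans with ((Rabs M + 1) * q (u n - l)%A).
  - apply Rmult_le_compat_r; lra.
  - rewrite Rmult_comm; apply Rmult_lt_reg_r with (/ (Rabs M + 1)).
    + apply Rinv_0_lt_compat; lra.
    + rewrite Rmult_assoc, Rinv_r, Rmult_1_r by lra; apply HN; exact Hn.
Qed.

Lemma converges_unique u l m : converges u l -> converges u m -> q (l - m)%A = 0.
Proof.
  intros Hl Hm.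
  destruct (q_ge0 (l - m)%A) as [H|H]; [|auto].
  destruct (Hl (q (l - m)%A / 2)) as [N1 H1]; [lra|].
  destruct (Hm (q (l - m)%A / 2)) as [N2 H2]; [lra|].
  specialize (H1 (N1 + N2)%nat ltac:(lia)); specialize (H2 (N1 + N2)%nat ltac:(lia)).
  pose proof (q_sub_triangle l (u (N1 + N2)%nat) m).
  rewrite (q_subC l (u (N1 + N2)%nat)) in *; lra.
Qed.

Lemma lincomb_ext (c d : nat -> C) (y z : nat -> A) n :
  (forall i, (i < n)%nat -> c i = d i /\ y i = z i) -> lincomb A c y n = lincomb A d z n.
Proof.
  induction n as [|n IH]; intros H; simpl; [reflexivity|].
  destruct (H n) as [-> ->]; [lia|].
  rewrite IH; [reflexivity|auto].
Qed.

Lemma lincomb_comb (c d : nat -> C) a y n :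
  lincomb A (fun i => c i + a * d i)%C y n = (lincomb A c y n + a *: lincomb A d y n)%A.
Proof.
  induction n as [|n IH]; simpl; [alg|rewrite IH; alg].
Qed.

Lemma lincomb_coord y n i : (i < n)%nat -> exists c, lincomb A c y n = y i.
Proof.
  intros Hi.
  assert (Z : forall m, (m <= i)%nat ->
    lincomb A (fun j => if Nat.eqb j i then RtoC 1 else RtoC 0) y m = 0%A).
  { induction m as [|m IH]; intros Hm; simpl; [reflexivity|].
    rewrite IH by lia; destruct (Nat.eqb_spec m i); [lia|alg]. }
  exists (fun j => if Nat.eqb j i then RtoC 1 else RtoC 0).
  induction Hi as [|n Hi IH]; simpl.
  - rewrite Z by lia; rewrite Nat.eqb_refl; alg.
  - rewrite IH; destruct (Nat.eqb_spec n i); [lia|alg].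
Qed.

Lemma lincomb_mem (P : A -> Prop) (y : nat -> A) c n :
  P 0%A -> (forall x z, P x -> P z -> P (x + z)%A) -> (forall a x, P x -> P (a *: x)%A) ->
  (forall i, (i < n)%nat -> P (y i)) -> P (lincomb A c y n).
Proof.
  intros P0 Pa Ps; induction n as [|n IH]; simpl; intros Hy; [exact P0|].
  apply Pa; [apply IH|apply Ps]; auto.
Qed.

(** The [y i] may be dependent modulo [q], so the combinations are bounded and not their
    coefficients. Asking that the limit be a combination builds in that the span is closed. *)
Definition span_compact y n : Prop := forall (c : nat -> nat -> C) M,
  (forall j, q (lincomb A (c j) y n) <= M) ->
  exists phi, nat_increasing phi /\ exists d,
    converges (fun j => lincomb A (c (phi j)) y n) (lincomb A d y n).

Lemma span_compact_closed y n x : span_compact y n ->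
  (forall delta, 0 < delta -> exists c, q (x - lincomb A c y n)%A < delta) ->
  exists c, q (x - lincomb A c y n)%A = 0.
Proof.
  intros Hc Hx.
  destruct (functional_choice (fun j c => q (x - lincomb A c y n)%A < / INR (j + 1)))
    as [c E].
  { intros j; apply Hx, Rinv_0_lt_compat, lt_0_INR; lia. }
  assert (cv : converges (fun j => lincomb A (c j) y n) x).
  { intros eps Heps; destruct (archimed_cor1 eps Heps) as [N [HN HN0]].
    exists N; intros j Hj; rewrite q_subC.
    eapply Rlt_trans; [apply E|].
    eapply Rle_lt_trans; [|exact HN].
    apply Rinv_le_contravar; [apply lt_0_INR; lia|apply le_INR; lia]. }
  destruct (Hc c (q x + 1)) as [phi [Hphi [d Hd]]].
  - intros j; eapply Rle_trans; [apply (q_le_sub _ x)|].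
    rewrite q_subC; apply Rplus_le_compat_l, Rlt_le.
    eapply Rlt_le_trans; [apply E|].
    rewrite <- Rinv_1; apply Rinv_le_contravar; [lra|].
    rewrite plus_INR; pose proof (pos_INR j); simpl; lra.
  - exists d; apply (converges_unique (fun j => lincomb A (c (phi j)) y n)); [|exact Hd].
    apply (converges_subseq _ _ _ Hphi cv).
Qed.

(** Induction on [n]. If [y n] has distance at least [delta > 0] from the span of the earlier
    vectors, its coefficient is at most [M / delta] and Bolzano-Weierstrass applies. Otherwise [y n]
    equals one of their combinations modulo [q] and can be eliminated. *)
Lemma span_compactness y n : span_compact y n.
Proof.
  induction n as [|n IH]; intros c M HM.
  { exists (fun j => j); split; [intros j; lia|].
    exists (fun _ => RtoC 0); intros eps Heps; exists O; intros j _; simpl.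
    rewrite addN, q0; exact Heps. }
  pose proof (q_ge0 (y n)) as Hy.
  destruct (classic (exists delta, 0 < delta /\
    forall d, delta <= q (y n - lincomb A d y n)%A)) as [[delta [Hdelta far]]|near].
  - assert (bound : forall j, Cmod (c j n) <= M / delta).
    { intros j.
      apply Rmult_le_reg_r with delta; [exact Hdelta|].
      unfold Rdiv; rewrite Rmult_assoc, Rinv_l, Rmult_1_r by lra.
      eapply Rle_trans; [|apply (HM j)]; simpl.
      destruct (classic ((c j n) = RtoC 0)) as [E|E].
      - rewrite E, Cmod_0, Rmult_0_l; apply q_ge0.
      - replace (lincomb A (c j) y n + c j n *: y n)%A
          with (c j n *: (y n - lincomb A (fun i => RtoC 0 + (- / c j n) * c j i)%C y n))%A.
        + rewrite q_scal; apply Rmult_le_compat_l; [apply Cmod_ge_0|apply far].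
        + rewrite lincomb_comb.
          assert (Z : forall m, lincomb A (fun _ => RtoC 0) y m = 0%A).
          { induction m as [|m IHm]; simpl; [reflexivity|rewrite IHm; alg]. }
          rewrite Z; alg_step; field; exact E. }
    destruct (bounded_subsequence_C (fun j => c j n) _ bound) as [phi [Hphi [t Ht]]].
    destruct (IH (fun j => c (phi j)) (M + M / delta * q (y n))) as [psi [Hpsi [d Hd]]].
    { intros j; eapply Rle_trans; [apply (q_le_sub _ (lincomb A (c (phi j)) y (S n)))|].
      apply Rplus_le_compat; [apply HM|].
      simpl; rewrite q_subC.
      match goal with |- q ?z <= _ =>
        replace z with (c (phi j) n *: y n)%A by alg
      end.
      rewrite q_scal; apply Rmult_le_compat_r; auto. }
    exists (fun j => phi (psi j)); split; [apply increasing_comp; auto|].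
    exists (fun i => if Nat.eqb i n then t else d i).
    intros eps Heps.
    destruct (Hd (eps / 2)) as [N1 H1]; [lra|].
    destruct (Ht (eps / (2 * (q (y n) + 1)))) as [N2 H2].
    { apply Rdiv_lt_0_compat; lra. }
    exists (N1 + N2)%nat; intros j Hj; simpl.
    rewrite Nat.eqb_refl.
    rewrite (lincomb_ext (fun i => if Nat.eqb i n then t else d i) d y y n).
    2: { intros i Hi; destruct (Nat.eqb_spec i n); [lia|auto]. }
    specialize (H1 j ltac:(lia)).
    specialize (H2 (psi j)).
    pose proof (increasing_ge psi j Hpsi).
    specialize (H2 ltac:(lia)).
    match goal with |- q ?z < _ =>
      replace z with ((lincomb A (c (phi (psi j))) y n - lincomb A d y n)
        + (c (phi (psi j)) n - t)%C *: y n)%A by alg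
    end.
    eapply Rle_lt_trans; [apply q_add|].
    rewrite q_scal.
    assert (Cmod (c (phi (psi j)) n - t) * q (y n) < eps / 2); [|lra].
    pose proof (Cmod_ge_0 (c (phi (psi j)) n - t)).
    apply Rle_lt_trans with (Cmod (c (phi (psi j)) n - t) * (q (y n) + 1));
      [apply Rmult_le_compat_l; lra|].
    apply Rlt_le_trans with (eps / (2 * (q (y n) + 1)) * (q (y n) + 1));
      [apply Rmult_lt_compat_r; lra|].
    right; field; lra.
  - destruct (span_compact_closed y n (y n) IH) as [d0 H0].
    { intros delta Hdelta; apply NNPP; intros H; apply near.
      exists delta; split; [exact Hdelta|].
      intros d; apply Rnot_lt_le; intros Hd; apply H; exists d; exact Hd. }
    (* Coefficients after substituting for [y n] its expression by [d0]. *)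
    set (c' := fun j i => (c j i + c j n * d0 i)%C).
    assert (diff : forall j l,
      q (lincomb A (c j) y (S n) - l)%A = q (lincomb A (c' j) y n - l)%A).
    { assert (W : forall a b, q (a - b)%A = 0 -> forall l, q (a - l)%A <= q (b - l)%A).
      { intros a b Hab l; pose proof (q_sub_triangle a b l); lra. }
      intros j l.
      assert (E : q (lincomb A (c j) y (S n) - lincomb A (c' j) y n)%A = 0).
      { unfold c'; rewrite lincomb_comb; simpl.
        match goal with |- q ?z = _ =>
          replace z with (c j n *: (y n - lincomb A d0 y n))%A by alg
        end.
        rewrite q_scal, H0; ring. }
      apply Rle_antisym; apply W; [|rewrite q_subC]; exact E. }
    destruct (IH c' M) as [phi [Hphi [d Hd]]].
    { intros j; specialize (HM j); specialize (diff j 0%A).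
      rewrite <- (addr0 A (lincomb A (c j) y (S n))) in HM.
      replace (lincomb A (c' j) y n) with (lincomb A (c' j) y n - 0)%A by alg.
      rewrite <- diff.
      replace (lincomb A (c j) y (S n) - 0)%A
        with (lincomb A (c j) y (S n) + 0)%A by alg.
      exact HM. }
    exists phi; split; [exact Hphi|].
    exists (fun i => if Nat.eqb i n then RtoC 0 else d i).
    replace (lincomb A (fun i => if Nat.eqb i n then RtoC 0 else d i) y (S n))
      with (lincomb A d y n).
    { intros eps Heps; destruct (Hd eps Heps) as [N HN].
      exists N; intros j Hj; rewrite diff; auto. }
    simpl; rewrite Nat.eqb_refl.
    rewrite (lincomb_ext (fun i => if Nat.eqb i n then RtoC 0 else d i) d y y n); [alg|].
    intros i Hi; destruct (Nat.eqb_spec i n); [lia|auto].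
Qed.

(** The infimum is positive, hence strictly below its double, and some value lies between. It is
    obtained as a supremum of [- f]. *)
Lemma almost_minimal (T : Type) (t : T) (f : T -> R) delta :
  0 < delta -> (forall t, delta <= f t) -> exists t0, forall t, f t0 <= 2 * f t.
Proof.
  intros Hdelta Hf.
  destruct (completeness (fun r => exists t, r = - f t)) as [m [Hm1 Hm2]].
  - exists 0; intros r [s ->]; specialize (Hf s); lra.
  - exists (- f t), t; reflexivity.
  - assert (m <= - delta).
    { apply Hm2; intros r [s ->]; specialize (Hf s); lra. }
    assert (W : exists t0, 2 * m < - f t0).
    { apply NNPP; intros H'.
      assert (m <= 2 * m); [|lra].
      apply Hm2; intros r [s ->]; apply Rnot_lt_le; intros Hs.
      apply H'; exists s; exact Hs. }
    destruct W as [t0 Ht0]; exists t0; intros s.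
    assert (- f s <= m) by (apply Hm1; exists s; reflexivity).
    lra.
Qed.

(** Riesz's lemma: normalise [x] minus an almost nearest combination. The [1 / 2] is the inverse of
    the factor 2 in [almost_minimal]. *)
Lemma riesz_vector (P : A -> Prop) x y n :
  (forall a b, P a -> P b -> P (a - b)%A) -> (forall c a, P a -> P (c *: a)%A) ->
  P x -> (forall c, P (lincomb A c y n)) -> (forall c, q (x - lincomb A c y n)%A <> 0) ->
  exists v, P v /\ q v <= 1 /\ forall c, 1 / 2 <= q (v - lincomb A c y n)%A.
Proof.
  intros Psub Pscal Px Py Hx.
  assert (far : exists delta, 0 < delta /\ forall c, delta <= q (x - lincomb A c y n)%A).
  { apply NNPP; intros H.
    destruct (span_compact_closed y n x (span_compactness y n)) as [c Hc];
      [|exact (Hx c Hc)].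
    intros delta Hdelta; apply NNPP; intros H'; apply H.
    exists delta; split; [exact Hdelta|].
    intros c; apply Rnot_lt_le; intros Hc; apply H'; exists c; exact Hc. }
  destruct far as [delta [Hdelta far]].
  destruct (almost_minimal _ (fun _ => RtoC 0) _ _ Hdelta far) as [c0 Hc0].
  set (r := q (x - lincomb A c0 y n)%A) in *.
  assert (Hr : 0 < r) by (specialize (far c0); fold r in far; lra).
  assert (Hr' : 0 < / r) by (apply Rinv_0_lt_compat; exact Hr).
  exists (RtoC (/ r) *: (x - lincomb A c0 y n))%A; repeat split; auto.
  - rewrite q_scal, Cmod_R, Rabs_right by lra; fold r; right; field; lra.
  - intros c.
    match goal with |- _ <= q ?z =>
      replace z with (RtoC (/ r) *: (x - lincomb A (fun i => c0 i + RtoC r * c i)%C y n))%A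
    end.
    + rewrite q_scal, Cmod_R, Rabs_right by lra.
      specialize (Hc0 (fun i => c0 i + RtoC r * c i)%C).
      apply Rmult_le_reg_l with r; [exact Hr|].
      rewrite <- Rmult_assoc, Rinv_r by lra; lra.
    + rewrite lincomb_comb; alg.
Qed.

Lemma riesz (P : A -> Prop) :
  P 0%A -> (forall a b, P a -> P b -> P (a + b)%A) -> (forall c a, P a -> P (c *: a)%A) ->
  (forall u, (forall n, P (u n)) -> (forall n, q (u n) <= 1) ->
    exists phi, nat_increasing phi /\ exists l, converges (fun n => u (phi n)) l) ->
  exists n y, (forall i, P (y i)) /\
    forall x, P x -> exists c, q (x - lincomb A c y n)%A = 0.
Proof.
  intros P0 Padd Pscal Pseq.
  assert (Psub : forall a b, P a -> P b -> P (a - b)%A).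
  { intros a b Ha Hb; rewrite opp_scal; auto. }
  apply NNPP; intros H.
  (* If no finite family spans, every finite family in [P] has a Riesz vector. The choice function
     is total; outside [P] its value is arbitrary. *)
  destruct (functional_choice (fun (ny : nat * (nat -> A)) v =>
    (forall i, P (snd ny i)) -> P v /\ q v <= 1 /\
      forall c, 1 / 2 <= q (v - lincomb A c (snd ny) (fst ny))%A)) as [F HF].
  { intros [n y]; simpl.
    destruct (classic (forall i, P (y i))) as [Py|Py];
      [|exists 0%A; intros Py'; contradiction].
    assert (W : exists x, P x /\ forall c, q (x - lincomb A c y n)%A <> 0).
    { apply NNPP; intros H'; apply H; exists n, y; split; [exact Py|].
      intros x Px; apply NNPP; intros Hx; apply H'; exists x; split; [exact Px|].
      intros c Hc; apply Hx; exists c; exact Hc. }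
    destruct W as [x [Px Hx]].
    destruct (riesz_vector P x y n) as [v Hv]; auto.
    - intros c; apply lincomb_mem; auto.
    - exists v; auto. }
  (* Each vector depends on all earlier ones, so the recursion builds the families: [g n] lists the
     first [n] vectors, padded by 0. *)
  set (g := fix g (n : nat) : nat -> A := match n with
    | O => fun _ => 0%A
    | S m => fun i => if Nat.eqb i m then F (m, g m) else g m i
    end).
  set (v := fun n => F (n, g n)).
  assert (Pg : forall n i, P (g n i)).
  { induction n as [|n IH]; intros i; simpl; [exact P0|].
    destruct (Nat.eqb i n); [apply (HF (n, g n)); exact IH|apply IH]. }
  assert (gv : forall n i, (i < n)%nat -> g n i = v i).
  { induction n as [|n IH]; intros i Hi; [lia|simpl].
    destruct (Nat.eqb_spec i n) as [->|]; [reflexivity|apply IH; lia]. }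
  destruct (Pseq v) as [phi [Hphi [l Hl]]].
  - intros n; apply (HF (n, g n)); apply Pg.
  - intros n; apply (HF (n, g n)); apply Pg.
  (* Two terms within [1 / 4] of the limit would be closer than [1 / 2] to each other, although the
     later one is at least [1 / 2] away from the span of its predecessors. *)
  - destruct (Hl (1 / 4)) as [N HN]; [lra|].
    pose proof (HN N (Nat.le_refl _)) as H1.
    pose proof (HN (S N) (Nat.le_succ_diag_r _)) as H2.
    specialize (Hphi N).
    destruct (lincomb_coord (g (phi (S N))) _ _ Hphi) as [c Hc].
    destruct (HF (phi (S N), g (phi (S N))) (Pg _)) as [_ [_ far]].
    specialize (far c); simpl fst in far; simpl snd in far.
    rewrite Hc, gv in far by exact Hphi.
    change (F (phi (S N), g (phi (S N)))) with (v (phi (S N))) in far.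
    pose proof (q_sub_triangle (v (phi (S N))) l (v (phi N))) as T.
    rewrite (q_subC l) in T; lra.
Qed.
End Seminorm.

(** * The quotient seminorm *)

(** [real] would send an infinite bound to 0; for a closed ideal, [qnorm_spec] shows that the bound
    is finite. *)
Definition qnorm (A : CstarAlgebra) (K : A -> Prop) (x : A) : R :=
  real (Glb_Rbar (fun r => exists k, K k /\ r = ⟦x - k⟧)).

Section Quotient.
Variable A : CstarAlgebra.
Variable K : A -> Prop.
Hypothesis K_closed_ideal : closed_ideal A K.
Notation q := (qnorm A K).
Implicit Types x y k : A.

Lemma closed_ideal_zero : K 0%A.
Proof. apply K_closed_ideal. Qed.

Lemma closed_ideal_add x y : K x -> K y -> K (x + y)%A.
Proof. apply K_closed_ideal. Qed.

Lemma closed_ideal_opp x : K x -> K (- x)%A.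
Proof. apply K_closed_ideal. Qed.

Lemma closed_ideal_scal c x : K x -> K (c *: x)%A.
Proof. apply K_closed_ideal. Qed.

Lemma closed_ideal_mul_l x k : K k -> K (x * k)%A.
Proof. apply K_closed_ideal; exact I. Qed.

Lemma closed_ideal_mul_r x k : K k -> K (k * x)%A.
Proof. apply K_closed_ideal; exact I. Qed.

Lemma qnorm_spec x :
  (forall k, K k -> q x <= ⟦x - k⟧) /\
  (forall eps, 0 < eps -> exists k, K k /\ ⟦x - k⟧ < q x + eps).
Proof.
  unfold qnorm.
  set (E := fun r => exists k, K k /\ r = ⟦x - k⟧).
  destruct (Glb_Rbar_correct E) as [lb glb].
  assert (fin : exists r, Glb_Rbar E = Finite r).
  { destruct (Glb_Rbar E) as [r| |].
    - exists r; reflexivity.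
    - exfalso; apply (lb ⟦x - 0⟧); exists 0%A; split; [apply closed_ideal_zero|reflexivity].
    - exfalso; apply (glb (Finite 0)); intros r [k [_ ->]]; apply norm_ge0. }
  destruct fin as [r Hr]; rewrite Hr in *; simpl; split.
  - intros k Kk; apply (lb ⟦x - k⟧); exists k; auto.
  - intros eps Heps; apply NNPP; intros H.
    assert (Rbar_le (Finite (r + eps)) (Finite r)) as H'; [|simpl in H'; lra].
    apply glb; intros s [k [Kk ->]]; simpl.
    apply Rnot_lt_le; intros Hk; apply H; exists k; auto.
Qed.

Lemma qnorm_le_norm x k : K k -> q x <= ⟦x - k⟧.
Proof. apply qnorm_spec. Qed.

Lemma qnorm_approx x eps : 0 < eps -> exists k, K k /\ ⟦x - k⟧ < q x + eps.
Proof. apply qnorm_spec. Qed.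

Lemma qnorm_le_of x c : (forall eps, 0 < eps -> exists k, K k /\ ⟦x - k⟧ < c + eps) -> q x <= c.
Proof.
  intros H; apply Rnot_lt_le; intros Hc.
  destruct (H (q x - c)) as [k [Kk E]]; [lra|].
  pose proof (qnorm_le_norm x k Kk); lra.
Qed.

Lemma qnorm_ge0 x : 0 <= q x.
Proof.
  apply Rnot_lt_le; intros H.
  destruct (qnorm_approx x (- q x)) as [k [Kk E]]; [lra|].
  pose proof (norm_ge0 A (x - k)%A); lra.
Qed.

Lemma qnorm_add x y : q (x + y)%A <= q x + q y.
Proof.
  apply qnorm_le_of; intros eps Heps.
  destruct (qnorm_approx x (eps / 2)) as [k [Kk Hk]]; [lra|].
  destruct (qnorm_approx y (eps / 2)) as [l [Kl Hl]]; [lra|].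
  exists (k + l)%A; split; [apply closed_ideal_add; auto|].
  replace (x + y - (k + l))%A with ((x - k) + (y - l))%A by alg.
  eapply Rle_lt_trans; [apply norm_triangle|lra].
Qed.

Lemma qnorm_scal c x : q (c *: x)%A = Cmod c * q x.
Proof.
  assert (W : forall c x, q (c *: x)%A <= Cmod c * q x).
  { clear c x; intros c x; apply qnorm_le_of; intros eps Heps.
    pose proof (Cmod_ge_0 c).
    destruct (qnorm_approx x (eps / (Cmod c + 1))) as [k [Kk Hk]].
    { apply Rdiv_lt_0_compat; lra. }
    exists (c *: k)%A; split; [apply closed_ideal_scal; auto|].
    replace (c *: x - c *: k)%A with (c *: (x - k))%A by alg.
    rewrite norm_scal.
    apply Rle_lt_trans with (Cmod c * (q x + eps / (Cmod c + 1))).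
    - apply Rmult_le_compat_l; lra.
    - rewrite Rmult_plus_distr_l; apply Rplus_lt_compat_l.
      apply Rmult_lt_reg_r with (Cmod c + 1); [lra|].
      unfold Rdiv; rewrite Rmult_assoc, Rmult_assoc, Rinv_l by lra; nra. }
  apply Rle_antisym; [apply W|].
  destruct (classic (c = RtoC 0)) as [->|Hc].
  - rewrite Cmod_0, Rmult_0_l; apply qnorm_ge0.
  - assert (Hm : 0 < Cmod c) by (apply Cmod_gt_0; exact Hc).
    pose proof (W (/ c)%C (c *: x)%A) as H.
    replace (/ c *: (c *: x))%A with x in H.
    2: { alg_step; field; exact Hc. }
    rewrite Cmod_inv in H by exact Hc.
    apply Rmult_le_reg_l with (/ Cmod c); [apply Rinv_0_lt_compat; exact Hm|].
    rewrite <- Rmult_assoc, Rinv_l by lra; lra.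
Qed.

Lemma qnorm_mul x y : q (x * y)%A <= q x * q y.
Proof.
  apply le_epsilon; intros eps Heps.
  pose proof (qnorm_ge0 x); pose proof (qnorm_ge0 y).
  (* Chosen so that [(q x + d) (q y + d) <= q x q y + eps]: the excess is [d (q x + q y + d)], and
     [d <= 1]. *)
  set (d := Rmin 1 (eps / (q x + q y + 1))).
  assert (0 < eps / (q x + q y + 1)) by (apply Rdiv_lt_0_compat; lra).
  assert (Hd : 0 < d) by (apply Rmin_glb_lt; lra).
  assert (Hd1 : d <= 1) by apply Rmin_l.
  assert (Hd2 : d * (q x + q y + 1) <= eps).
  { apply Rle_trans with (eps / (q x + q y + 1) * (q x + q y + 1)).
    - apply Rmult_le_compat_r; [lra|apply Rmin_r].
    - right; field; lra. }
  destruct (qnorm_approx x d Hd) as [k [Kk Hk]].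
  destruct (qnorm_approx y d Hd) as [l [Kl Hl]].
  eapply Rle_trans; [apply (qnorm_le_norm _ (k * y + x * l - k * l)%A)|].
  - auto 6 using closed_ideal_add, closed_ideal_opp, closed_ideal_mul_l, closed_ideal_mul_r.
  - replace (x * y - (k * y + x * l - k * l))%A with ((x - k) * (y - l))%A by alg.
    eapply Rle_trans; [apply norm_mul|].
    apply Rle_trans with ((q x + d) * (q y + d)).
    + apply Rmult_le_compat; try apply norm_ge0; lra.
    + nra.
Qed.

Lemma qnorm_eq0 x : q x = 0 <-> K x.
Proof.
  split; intros H.
  - apply closed_approx; [apply K_closed_ideal|]; intros eps Heps.
    destruct (qnorm_approx x eps Heps) as [k [Kk E]].
    exists k; split; [exact Kk|lra].
  - pose proof (qnorm_le_norm x x H) as E; rewrite addN, norm0 in E.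
    pose proof (qnorm_ge0 x); lra.
Qed.

(** If [m] in [K] is self-adjoint and nearly nearest to [x^* x], its resolvent [S] gives an element
    [x S] of [K] with [⟦x - x S⟧^2] nearly at most [q (x^* x)]. *)
Lemma qnorm_cstar x : q x * q x <= q (x^* * x)%A.
Proof.
  apply le_epsilon; intros eps Heps.
  destruct (qnorm_approx (x^* * x)%A (eps / 2)) as [k [Kk Hk]]; [lra|].
  (* As [x^* x] is self-adjoint, replacing [k] by its real part does not increase the distance. *)
  set (m := (RtoC (1 / 2) *: (k + k^*))%A).
  assert (Hm : (m^*)%A = m) by (unfold m; alg).
  assert (Km : K m).
  { pose proof (closed_ideal_star A K k K_closed_ideal Kk).
    unfold m; auto using closed_ideal_scal, closed_ideal_add. }
  assert (Hxm : ⟦x^* * x - m⟧ <= ⟦x^* * x - k⟧).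
  { replace (x^* * x - m)%A
      with (RtoC (1 / 2) *: ((x^* * x - k) + (x^* * x - k)^*))%A by (unfold m; alg).
    rewrite norm_scal, Cmod_R, Rabs_right by lra.
    pose proof (norm_triangle A (x^* * x - k)%A ((x^* * x - k)^*)%A) as T.
    rewrite norm_star in T; lra. }
  destruct (approximate_unit A x m (eps / 2) Hm) as [lam [S [Hlam [HS E]]]]; [lra|].
  assert (KS : K S).
  { apply resolves_mem with (whole A) m lam; auto; [apply K_closed_ideal|exact I]. }
  pose proof (qnorm_le_norm x (x * S)%A (closed_ideal_mul_l _ _ KS)).
  pose proof (qnorm_ge0 x).
  assert (q x * q x <= ⟦x - x * S⟧ * ⟦x - x * S⟧) by (apply Rmult_le_compat; lra).
  lra.
Qed.

Lemma qnorm_leP x c : qnorm_le A K x c <-> q x <= c.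
Proof.
  split; intros H.
  - apply le_epsilon; intros eps Heps.
    destruct (H eps Heps) as [k [Kk E]].
    pose proof (qnorm_le_norm x k Kk); lra.
  - intros eps Heps; destruct (qnorm_approx x eps Heps) as [k [Kk E]].
    exists k; split; [exact Kk|lra].
Qed.

Lemma qcvg_toP u y : qcvg_to A K u y <-> converges A q u y.
Proof.
  split; intros H eps Heps; destruct (H eps Heps) as [N HN]; exists N; intros n Hn.
  - destruct (HN n Hn) as [k [Kk E]].
    eapply Rle_lt_trans; [apply (qnorm_le_norm _ k Kk)|exact E].
  - specialize (HN n Hn).
    destruct (qnorm_approx (u n - y)%A (eps - q (u n - y)%A)) as [k [Kk E]]; [lra|].
    exists k; split; [exact Kk|lra].
Qed.
End Quotient.

(** * Compact and finite rank elements modulo a closed ideal *)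

Section Elements.
Variable A : CstarAlgebra.
Variables I K : A -> Prop.
Hypothesis HI : closed_ideal A I.
Hypothesis HK : closed_ideal A K.
Notation q := (qnorm A K).
Notation conv := (converges A q).

Let q_add := qnorm_add A K HK.
Let q_scal := qnorm_scal A K HK.
Let q_mul := qnorm_mul A K HK.
Let q_ge0 := qnorm_ge0 A K HK.
Let q_le_sub := q_le_sub A q q_add.

Lemma compact_elt_modP a : compact_elt_mod A I K a <->
  forall u : nat -> A, (forall n, I (u n)) -> (exists c, forall n, q (u n) <= c) ->
    exists phi, nat_increasing phi /\
      exists y, I y /\ conv (fun n => a * (u (phi n) * a))%A y.
Proof.
  split; intros H u Iu [c Hc].
  - destruct (H u Iu) as [phi [Hphi [y [Iy Hy]]]].
    + exists c; intros n; apply qnorm_leP; auto.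
    + exists phi; split; [exact Hphi|]; exists y; split; [exact Iy|].
      apply qcvg_toP in Hy; auto.
  - destruct (H u Iu) as [phi [Hphi [y [Iy Hy]]]].
    + exists c; intros n; apply qnorm_leP; auto.
    + exists phi; split; [exact Hphi|]; exists y; split; [exact Iy|].
      apply qcvg_toP; auto.
Qed.

(** Since [(b a) x (b a) = b (a (x b) a)], the inner factor [b] is absorbed into the bounded
    argument. *)
Lemma compact_elt_mul_l b a : compact_elt_mod A I K a -> compact_elt_mod A I K (b * a)%A.
Proof.
  intros H; apply compact_elt_modP; intros u Iu [c Hc].
  destruct (proj1 (compact_elt_modP a) H (fun n => u n * b)%A) as [phi [Hphi [y [Iy Hy]]]].
  - intros n; apply closed_ideal_mul_r; auto.
  - exists (c * q b); intros n.
    eapply Rle_trans; [apply q_mul|].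
    apply Rmult_le_compat_r; auto.
  - exists phi; split; [exact Hphi|]; exists (b * y)%A.
    split; [apply closed_ideal_mul_l; auto|].
    apply (converges_lipschitz A q q_add q_scal
      (fun n => a * (u (phi n) * b * a))%A _ y _ (q b)); [|exact Hy].
    intros n.
    replace (b * a * (u (phi n) * (b * a)) - b * y)%A
      with (b * (a * (u (phi n) * b * a) - y))%A by alg.
    apply q_mul.
Qed.

Lemma finite_rank_compact a :
  finite_rank_elt_mod A I K a -> compact_elt_mod A I K a.
Proof.
  intros [n [y [Iy Hy]]]; apply compact_elt_modP; intros u Iu [c Hc].
  destruct (functional_choice (fun j d => K (a * (u j * a) - lincomb A d y n)%A))
    as [d Hd]; [intros j; apply Hy; auto|].
  assert (Hd0 : forall j, q (lincomb A (d j) y n - a * (u j * a))%A = 0).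
  { intros j; rewrite (q_subC A q q_scal); apply qnorm_eq0; auto. }
  destruct (span_compactness A q q_add q_scal y n d (q a * (c * q a)))
    as [phi [Hphi [e He]]].
  { intros j; eapply Rle_trans; [apply (q_le_sub _ (a * (u j * a))%A)|].
    rewrite Hd0, Rplus_0_r.
    eapply Rle_trans; [apply q_mul|].
    apply Rmult_le_compat_l; [apply q_ge0|].
    eapply Rle_trans; [apply q_mul|].
    apply Rmult_le_compat_r; [apply q_ge0|auto]. }
  exists phi; split; [exact Hphi|]; exists (lincomb A e y n); split.
  - apply lincomb_mem; auto;
      [apply closed_ideal_zero|apply closed_ideal_add|apply closed_ideal_scal]; auto.
  - apply (converges_lipschitz A q q_add q_scal
      (fun j => lincomb A (d (phi j)) y n) _ (lincomb A e y n) _ 1); [|exact He].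
    intros j; rewrite Rmult_1_l.
    pose proof (q_sub_triangle A q q_add (a * (u (phi j) * a))%A
      (lincomb A (d (phi j)) y n) (lincomb A e y n)) as T.
    rewrite (q_subC A q q_scal (a * _)%A (lincomb A (d _) y n)), Hd0 in T; lra.
Qed.

Lemma converges_mul u v a b : (forall n, q (v n) <= 1) -> conv u a -> conv v b ->
  conv (fun n => u n * v n)%A (a * b)%A.
Proof.
  intros Hv Hu Hb eps Heps.
  pose proof (q_ge0 a) as Ha.
  destruct (Hu (eps / 2)) as [N1 H1]; [lra|].
  destruct (Hb (eps / (2 * (q a + 1)))) as [N2 H2]; [apply Rdiv_lt_0_compat; lra|].
  exists (N1 + N2)%nat; intros n Hn.
  specialize (H1 n ltac:(lia)); specialize (H2 n ltac:(lia)).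
  replace (u n * v n - a * b)%A with ((u n - a) * v n + a * (v n - b))%A by alg.
  eapply Rle_lt_trans; [apply q_add|].
  pose proof (q_mul (u n - a)%A (v n)); pose proof (q_mul a (v n - b)%A).
  assert (q (u n - a)%A * q (v n) <= q (u n - a)%A * 1)
    by (apply Rmult_le_compat_l; auto).
  assert (q a * q (v n - b)%A <= (q a + 1) * q (v n - b)%A)
    by (apply Rmult_le_compat_r; [apply q_ge0|lra]).
  assert ((q a + 1) * q (v n - b)%A < (q a + 1) * (eps / (2 * (q a + 1))))
    by (apply Rmult_lt_compat_l; lra).
  replace ((q a + 1) * (eps / (2 * (q a + 1)))) with (eps / 2) in * by (field; lra).
  lra.
Qed.

(* On the range of [x |-> y x y] the compact operator [x |-> z x z] is the identity. *)
Lemma finite_rank_of_compact_unit y z : compact_elt_mod A I K z -> I y ->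
  K (y - y * z)%A -> K (y - z * y)%A -> finite_rank_elt_mod A I K y.
Proof.
  intros Hz Iy Kyz Kzy.
  destruct (riesz A q q_add q_scal (fun v => I v /\ K (v - z * (v * z))%A))
    as [n [e [He Hspan]]].
  - split; [apply closed_ideal_zero; auto|].
    replace (0 - z * (0 * z))%A with (0 : A)%A by alg.
    apply closed_ideal_zero; auto.
  - intros a b [Ia Ka] [Ib Kb]; split; [apply closed_ideal_add; auto|].
    replace (a + b - z * ((a + b) * z))%A
      with ((a - z * (a * z)) + (b - z * (b * z)))%A by alg.
    apply closed_ideal_add; auto.
  - intros c a [Ia Ka]; split; [apply closed_ideal_scal; auto|].
    replace (c *: a - z * (c *: a * z))%A with (c *: (a - z * (a * z)))%A by alg.
    apply closed_ideal_scal; auto.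
  - intros u Pu Hu.
    destruct (proj1 (compact_elt_modP z) Hz u) as [phi [Hphi [l [Il Hl]]]];
      [apply Pu|exists 1; exact Hu|].
    exists phi; split; [exact Hphi|]; exists l.
    apply (converges_lipschitz A q q_add q_scal
      (fun n => z * (u (phi n) * z))%A _ l _ 1); [|exact Hl].
    intros n; rewrite Rmult_1_l.
    pose proof (q_sub_triangle A q q_add (u (phi n)) (z * (u (phi n) * z))%A l) as T.
    assert (E : q (u (phi n) - z * (u (phi n) * z))%A = 0)
      by (apply qnorm_eq0; [exact HK|apply Pu]).
    lra.
  - exists n, e; split; [intros i _; apply He|].
    intros x Ix.
    destruct (Hspan (y * (x * y))%A) as [c Hc].
    + split; [apply closed_ideal_mul_r; auto|].
      (* Each hypothesis on [y] and [z] kills one summand. *)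
      replace (y * (x * y) - z * (y * (x * y) * z))%A
        with ((y - z * y) * (x * y) + (z * (y * x)) * (y - y * z))%A by alg.
      apply closed_ideal_add; auto;
        [apply closed_ideal_mul_r|apply closed_ideal_mul_l]; auto.
    + exists c; apply qnorm_eq0; auto.
Qed.

(** * Powers of a self-adjoint compact element of quotient norm one *)

Section Powers.
Variable h : A.
Hypothesis Ih : I h.
Hypothesis h_star : (h^*)%A = h.
Hypothesis h_norm : q h = 1.
Hypothesis h_compact : compact_elt_mod A I K h.

(* There is no unit, so [pw n] is the power of exponent [n + 1]. *)
Definition pw (n : nat) : A := Nat.iter n (mul A h) h.

Lemma pw_add m n : pw (S (m + n)) = (pw m * pw n)%A.
Proof.
  induction m as [|m IH]; [reflexivity|].
  change (h * pw (S (m + n)) = h * pw m * pw n)%A.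
  rewrite IH; apply mulA.
Qed.

Lemma pw_mem n : I (pw n).
Proof.
  destruct n as [|n]; [exact Ih|].
  change (I (h * pw n)%A); apply closed_ideal_mul_r; auto.
Qed.

Lemma pw_succ_r n : pw (S n) = (pw n * h)%A.
Proof. rewrite <- (Nat.add_0_r n) at 1; apply pw_add. Qed.

Lemma pw_star n : ((pw n)^*)%A = pw n.
Proof.
  induction n as [|n IH]; [exact h_star|].
  rewrite pw_succ_r at 1; rewrite star_mul, IH, h_star; reflexivity.
Qed.

Lemma pw_norm_le n : q (pw n) <= 1.
Proof.
  induction n as [|n IH]; [simpl; lra|].
  eapply Rle_trans; [apply q_mul|]; fold (pw n).
  rewrite h_norm, Rmult_1_l; exact IH.
Qed.

(** Squaring a self-adjoint power keeps the bound by [qnorm_cstar], so it holds for arbitrarily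
    large exponents. It descends to smaller ones because the complementary power has norm at most
    1. *)
Lemma pw_norm_ge n : 1 <= q (pw n).
Proof.
  assert (W : exists m, (n <= m)%nat /\ 1 <= q (pw m)).
  { induction n as [|k [m [Hm E]]]; [exists O; simpl; split; [lia|lra]|].
    exists (S (m + m)); split; [lia|].
    rewrite pw_add; rewrite <- (pw_star m) at 1.
    eapply Rle_trans; [|apply qnorm_cstar; exact HK].
    rewrite <- (Rmult_1_l 1); apply Rmult_le_compat; lra. }
  destruct W as [m [Hm E]].
  destruct (Nat.eq_dec n m) as [->|Hnm]; [exact E|].
  replace m with (S (n + (m - n - 1))) in E by lia.
  rewrite pw_add in E.
  eapply Rle_trans; [exact E|].
  eapply Rle_trans; [apply q_mul|].
  rewrite <- (Rmult_1_r (q (pw n))) at 2.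
  apply Rmult_le_compat_l; [apply q_ge0|apply pw_norm_le].
Qed.

(** The compact operator of [h] is applied to the bounded sequence [pw (m n)]; its two factors [h]
    account for the [+ 2]. *)
Lemma pw_subsequence (m : nat -> nat) : exists phi, nat_increasing phi /\
  exists l, I l /\ conv (fun n => pw (m (phi n) + 2)) l.
Proof.
  destruct (proj1 (compact_elt_modP h) h_compact (fun n => pw (m n)))
    as [phi [Hphi [l [Il Hl]]]].
  - intros n; apply pw_mem.
  - exists 1; intros n; apply pw_norm_le.
  - exists phi; split; [exact Hphi|]; exists l; split; [exact Il|].
    intros eps Heps; destruct (Hl eps Heps) as [N HN].
    exists N; intros n Hn; specialize (HN n Hn).
    rewrite Nat.add_comm; simpl plus.
    change (pw (S (S (m (phi n))))) with (h * pw (S (m (phi n))))%A.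
    rewrite pw_succ_r; exact HN.
Qed.

(* If [h^(N j) -> y] and [h^(N (j + 10) - N j) -> z] along a subsequence then [y z = y = z y],
   and [z] inherits compactness from [h] because the exponents leave room for a factor [h]
   on both sides. *)
Lemma finite_rank_limit : exists y, I y /\ ~ K y /\ finite_rank_elt_mod A I K y.
Proof.
  destruct (pw_subsequence (fun n => n)) as [phi [Hphi [y [Iy Hy]]]].
  (* Of the 5 removed, two come back from [pw_subsequence], two from the outer factors of
     [z = h w h], and one from the shift in [pw_add]. The step 10 leaves a gap large enough for
     these natural subtractions to be exact. *)
  destruct (pw_subsequence (fun n => phi (n + 10) - phi n - 5)%nat)
    as [psi [Hpsi [w [Iw Hw]]]].
  set (z := (h * w * h)%A).
  set (d := fun n => (phi (psi n + 10)%nat - phi (psi n) - 1)%nat).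
  assert (gap : forall n, (phi n + 10 <= phi (n + 10))%nat).
  { assert (G : forall k n, (phi n + k <= phi (n + k))%nat).
    { induction k as [|k IH]; intros n; [rewrite !Nat.add_0_r; lia|].
      specialize (IH n); pose proof (Hphi (n + k)%nat).
      rewrite (Nat.add_succ_r n); lia. }
    intros n; apply G. }
  assert (Hz : conv (fun n => pw (d n)) z).
  { apply (converges_lipschitz A q q_add q_scal
      (fun n => pw (phi (psi n + 10)%nat - phi (psi n) - 5 + 2)) _ w _ 1); [|exact Hw].
    intros n; cbv beta; rewrite Rmult_1_l; specialize (gap (psi n)).
    replace (d n) with (S (S (phi (psi n + 10)%nat - phi (psi n) - 5 + 2)))%nat
      by (unfold d; lia).
    set (e := (phi (psi n + 10)%nat - phi (psi n) - 5 + 2)%nat).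
    rewrite pw_succ_r; change (pw (S e)) with (h * pw e)%A.
    replace (h * pw e * h - z)%A with (h * ((pw e - w) * h))%A by (unfold z; alg).
    eapply Rle_trans; [apply q_mul|]; rewrite h_norm, Rmult_1_l.
    eapply Rle_trans; [apply q_mul|]; rewrite h_norm; lra. }
  assert (Hy' : conv (fun n => pw (phi (psi n) + 2)) y)
    by apply (converges_subseq A q _ _ _ Hpsi Hy).
  assert (Hy'' : conv (fun n => pw (phi (psi n + 10)%nat + 2)) y).
  { apply (converges_subseq A q (fun n => pw (phi n + 2)) y (fun n => psi n + 10)%nat);
      [|exact Hy].
    intros n; specialize (Hpsi n); lia. }
  exists y; split; [exact Iy|]; split.
  - intros Ky.
    destruct (Hy (1 / 2)) as [N HN]; [lra|].
    specialize (HN N (Nat.le_refl _)).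
    pose proof (pw_norm_ge (phi N + 2)).
    pose proof (q_le_sub (pw (phi N + 2)) y).
    apply (qnorm_eq0 A K HK) in Ky; lra.
  - apply finite_rank_of_compact_unit with z.
    + unfold z; apply compact_elt_mul_l; exact h_compact.
    + exact Iy.
    (* The sequence [pw (phi (psi n + 10) + 2)] tends to [y], and, factored as a power tending to
       [y] times [pw (d n)], also to [y z]. The next case takes the factors in the other order. *)
    + apply (qnorm_eq0 A K HK).
      apply (converges_unique A q q_add q_scal (fun n => pw (phi (psi n + 10)%nat + 2)));
        [exact Hy''|].
      assert (M : conv (fun n => pw (phi (psi n) + 2) * pw (d n))%A (y * z)%A).
      { apply converges_mul; auto; intros n; apply pw_norm_le. }
      intros eps Heps; destruct (M eps Heps) as [N HN].
      exists N; intros n Hn; specialize (HN n Hn); specialize (gap (psi n)).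
      rewrite <- pw_add in HN.
      replace (phi (psi n + 10)%nat + 2)%nat with (S (phi (psi n) + 2 + d n))
        by (unfold d; lia).
      exact HN.
    + apply (qnorm_eq0 A K HK).
      apply (converges_unique A q q_add q_scal (fun n => pw (phi (psi n + 10)%nat + 2)));
        [exact Hy''|].
      assert (M : conv (fun n => pw (d n) * pw (phi (psi n) + 2))%A (z * y)%A).
      { apply converges_mul; auto; intros n; apply pw_norm_le. }
      intros eps Heps; destruct (M eps Heps) as [N HN].
      exists N; intros n Hn; specialize (HN n Hn); specialize (gap (psi n)).
      rewrite <- pw_add in HN.
      replace (phi (psi n + 10)%nat + 2)%nat with (S (d n + (phi (psi n) + 2)))
        by (unfold d; lia).
      exact HN.
Qed.
End Powers.

Lemma compact_to_finite_rank a : I a -> ~ K a -> compact_elt_mod A I K a ->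
  exists y, I y /\ ~ K y /\ finite_rank_elt_mod A I K y.
Proof.
  intros Ia Ka Ha.
  assert (qa : 0 < q (a^* * a)%A).
  { assert (0 < q a).
    { destruct (q_ge0 a) as [E|E]; [exact E|].
      exfalso; apply Ka, (qnorm_eq0 A K HK); auto. }
    eapply Rlt_le_trans; [|apply qnorm_cstar; exact HK].
    apply Rmult_lt_0_compat; auto. }
  pose proof (Rinv_0_lt_compat _ qa) as qa'.
  set (r := / q (a^* * a)%A) in *.
  apply (finite_rank_limit (RtoC r *: a^* * a)%A).
  - apply closed_ideal_mul_l; auto.
  - alg.
  - rewrite <- scal_mull, q_scal, Cmod_R, Rabs_right by lra.
    unfold r; field; lra.
  - apply compact_elt_mul_l; exact Ha.
Qed.
End Elements.

(** Hypocompactness and hypofiniteness quantify over ideals of [I], while the quotient seminorm is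
    studied for ideals of [A]; this bridges the two. *)
Lemma ideal_of_closed_ideal (A : CstarAlgebra) (I K : A -> Prop) :
  closed_ideal A I -> is_ideal_in A I K -> is_closed A K -> closed_ideal A K.
Proof.
  intros HI HK HKc; apply sub_ideal_closed_ideal with I; auto.
  - apply HI.
  - intros x; apply closed_ideal_star; exact HI.
Qed.

Lemma hypofinite_hypocompact (A : CstarAlgebra) (I : A -> Prop) :
  closed_ideal A I -> hypofinite A I -> hypocompact A I.
Proof.
  intros HI H K HK HKc Hne.
  destruct (H K HK HKc Hne) as [a [Ia [Ka Ha]]].
  exists a; repeat split; auto.
  apply finite_rank_compact; auto.
  apply ideal_of_closed_ideal with I; auto.
Qed.

Lemma hypocompact_hypofinite (A : CstarAlgebra) (I : A -> Prop) :
  closed_ideal A I -> hypocompact A I -> hypofinite A I.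
Proof.
  intros HI H K HK HKc Hne.
  destruct (H K HK HKc Hne) as [a [Ia [Ka Ha]]].
  apply compact_to_finite_rank with a; auto.
  apply ideal_of_closed_ideal with I; auto.
Qed.

Theorem theorem4p1 (A : CstarAlgebra) (Ihf Ihc : A -> Prop) :
  is_Rhf A Ihf -> is_Rhc A Ihc -> forall x : A, Ihf x <-> Ihc x.
Proof.
  intros [HF [hf maxF]] [HC [hc maxC]] x; split.
  (* The two properties agree on closed ideals, so each radical competes in the maximality of the
     other. *)
  - apply maxC; auto using hypofinite_hypocompact.
  - apply maxF; auto using hypocompact_hypofinite.
Qed.
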